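(* Let $\mu_-\le0\le\mu_+$, $\mu_-<\mu_+$, and let $X\in sSL_{\mu_-,\mu_+}$ with characteristic exponent $\psi$. Let $\nu'\in(0,2]\cup\{0+,1+\}$ and $\mathcal{C}_+=\mathcal{C}_{\gamma'_-,\gamma'_+}$, where $-\pi/2\le\gamma'_-\le0\le\gamma'_+\le\pi/2$, $|\gamma'_-|+\gamma'_+>0$, and suppose that for every closed interval $[\gamma'_{1,-},\gamma'_{1,+}]\subset(\gamma'_-,\gamma'_+)$ there exist $c,R>0$ such that $$\Re\psi(\rho e^{i\varphi})\ge c\rho^{\nu'}\quad\text{for all }\varphi\in[\gamma'_{1,-},\gamma'_{1,+}],\ \rho>R.$$ Then $X$ is SINH-regular of type $((\mu_-,\mu_+);\mathbb{C}\setminus i\mathbb{R};\mathcal{C}_+)$, and there exists $\nu\in[\nu',2]$ such that the order of $X$ is $(\nu',\nu)$.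
   Context: Characteristic exponent: $\mathbb{E}[e^{i\xi X_t}]=e^{-t\psi(\xi)}$, and $\psi(\xi)=-i\mu\xi+\psi^0(\xi)$; analytic continuations are denoted by the same letters. Cones: $\mathcal{C}_{\gamma_-,\gamma_+}=\{e^{i\varphi}\rho:\rho>0,\ \varphi\in(\gamma_-,\gamma_+)\cup(\pi-\gamma_+,\pi-\gamma_-)\}$; $\mathcal{C}_{-\pi/2,\pi/2}=\mathbb{C}\setminus i\mathbb{R}$. Conventions for orders: $\rho^{0+}:=\ln\rho$, $\rho^{1+}:=\rho\ln\rho$ for $\rho>1$. The set $(0,2]\cup\{0+,1+\}$ is linearly ordered by the usual order on $(0,2]$ together with $0+<\nu$ for all $\nu\in(0,2]\cup\{1+\}$, $1<1+$, and $1+<\nu$ for $\nu\in(1,2]$. SINH-regularity: $X$ is SINH-regular of type $((\mu_-,\mu_+);\mathcal{C};\mathcal{C}_+)$ and order $(\nu',\nu)$ if: $\mu_-<0\le\mu_+$ or $\mu_-\le0<\mu_+$; $\mathcal{C}=\mathcal{C}_{\gamma_-,\gamma_+}$, $\mathcal{C}_+=\mathcal{C}_{\gamma'_-,\gamma'_+}$ with $\gamma_-<0<\gamma_+$, $\gamma_-\le\gamma'_-\le0\le\gamma'_+\le\gamma_+$, $|\gamma'_-|+\gamma'_+>0$; $\psi^0$ admits analytic continuation to $i(\mu_-,\mu_+)+(\mathcal{C}\cup\{0\})$; for all $\gamma_{1,-}\in(\gamma_-,0)$, $\gamma_{1,+}\in(0,\gamma_+)$ there exist $C,R>0$ with $|\psi(\rho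 e^{i\varphi})|\le C\rho^\nu$ for $\varphi\in[\gamma_{1,-},\gamma_{1,+}]$, $\rho>R$; and for every $[\gamma'_{1,-},\gamma'_{1,+}]\subset(\gamma'_-,\gamma'_+)$ there exist $c,R>0$ with $\Re\psi(\rho e^{i\varphi})\ge c\rho^{\nu'}$ for $\varphi\in[\gamma'_{1,-},\gamma'_{1,+}]$, $\rho>R$. sSL-processes: $\mathrm{SM}_0$ is the set of non-negative measures $\mathcal{G}$ on $(0,+\infty)$ with $\int(1+t)^{-1}\mathcal{G}(dt)<\infty$; $\mathrm{SM}_\mu$ ($\mu>0$) those supported on $[\mu,+\infty)$. $\mathrm{SLM}_\mu$ ($\mu\ge0$): measures $\mathcal{G}$ for which there exist $a_2,a_1\ge0$, $a_2+a_1>0$, with $(a_2t^2+a_1t)^{-1}\mathcal{G}(dt)\in\mathrm{SM}_\mu$. $\mathrm{sSLM}_\mu$: signed measures $\mathcal{G}_1-\mathcal{G}_2$, $\mathcal{G}_j\in\mathrm{SLM}_\mu$, with Laplace transform non-negative on $(0,+\infty)$. $X\in sSL_{\mu_-,\mu_+}$ if its Lévy density is $f(x)=\mathbf{1}_{(-\infty,0)}(x)\int_{(0,+\infty)}e^{tx}\mathcal{G}_-(dt)+\mathbf{1}_{(0,+\infty)}(x)\int_{(0,+\infty)}e^{-tx}\mathcal{G}_+(dt)$ with $\mathcal{G}_-\in\mathrm{sSLM}_{\mu_+}$, $\mathcal{G}_+\in\mathrm{sSLM}_{-\mu_-}$. *)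

(* Defs.v *)
From HB Require Import structures.
From mathcomp Require Import all_boot all_order all_algebra.
From mathcomp Require Import complex ring lra.
From mathcomp Require Import all_classical all_reals all_analysis.

Set Implicit Arguments.
Unset Strict Implicit.
Unset Printing Implicit Defensive.

Import Order.TTheory GRing.Theory Num.Theory.
Import numFieldNormedType.Exports.

Local Open Scope classical_set_scope.
Local Open Scope ring_scope.
Local Open Scope complex_scope.

Section complex_analysis.
Context {R : realType}.
Implicit Types (z : R[i]) (D : set R[i]).

Definition cexp z : R[i] :=
  (expR (complex.Re z) * cos (complex.Im z)) +i*
  (expR (complex.Re z) * sin (complex.Im z)).

Definition polar (rho phi : R) : R[i] := rho%:C * cexp ('i%C * phi%:C).

Definition cintegral d (T : measurableType d) (m : {measure set T -> \bar R})
    (f : T -> R[i]) : R[i] :=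
  (Rintegral m setT (fun x => complex.Re (f x))) +i*
  (Rintegral m setT (fun x => complex.Im (f x))).

Definition holomorphic_on D (f : R[i] -> R[i]) : Prop :=
  forall z, D z -> derivable (f : R[i]^o -> R[i]^o) z 1.

(* [Psi] continues [psi], a function on the real line, to [D]; when [0] is not
   in [D] (see [strip_cone] below) the two agree on the rest of the line. *)
Definition analytic_continuation D (psi : R -> R[i]) (Psi : R[i] -> R[i]) :
    Prop :=
  holomorphic_on D Psi /\ forall x : R, D x%:C -> Psi x%:C = psi x.

Definition cone (gm gp : R) : set R[i] :=
  [set z | exists rho phi : R, [/\ 0 < rho,
    gm < phi < gp \/ pi - gp < phi < pi - gm & z = polar rho phi]].

(* i (mum, mup) + (C_{gm, gp} \cup {0}) *)
Definition strip_cone (mum mup gm gp : R) : set R[i] :=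
  [set 'i%C * a%:C + w | a in `]mum, mup[%classic
                         & w in cone gm gp `|` [set 0]].

Lemma cone_halfpi : cone (- (pi / 2)) (pi / 2) = [set z | complex.Re z != 0].
Proof.
have piE : pi / 2 + pi / 2 = pi :> R by rewrite -splitr.
have sin_atan (u : R) : sin (atan u) = u / Num.sqrt (1 + u ^+ 2).
  have := atanK u; rewrite /tan -cos_atan => {2}<-; rewrite divfK//.
  by rewrite gt_eqF// cos_gt0_pihalf// atan_gtNpi2 atan_ltpi2.
have polarE (r p : R) : polar r p = (r * cos p) +i* (r * sin p).
  rewrite /polar /cexp.
  by apply/eqP; rewrite eq_complex /=; apply/andP; split; apply/eqP;
    rewrite !(mul0r, mulr0, mul1r, sub0r, subr0, addr0, add0r, oppr0, expR0).
have xy_polar (x y : R) : 0 < x ->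
    x +i* y = polar (x * Num.sqrt (1 + (y / x) ^+ 2)) (atan (y / x)).
  move=> x0; rewrite polarE cos_atan sin_atan.
  have s0 : Num.sqrt (1 + (y / x) ^+ 2) != 0.
    by rewrite gt_eqF// sqrtr_gt0 ltr_wpDr// sqr_ge0.
  have xn0 : x != 0 by rewrite gt_eqF.
  by move: (Num.sqrt _) s0 => s s0; congr (_ +i* _); field; rewrite ?s0.
apply/seteqP; split => [z [r [p [r0 pI ->]]]|[x y] /=].
  rewrite /mkset polarE /= mulf_neq0//; first by rewrite gt_eqF.
  case: pI => [pI|/andP[p1 p2]]; first by rewrite gt_eqF// cos_gt0_pihalf.
  rewrite -oppr_eq0 -cosDpi -[p + pi]addrC.
  have -> : pi + p = (p - pi) + pi *+ 2 by rewrite mulr2n addrC; ring.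
  rewrite cosD2pi gt_eqF// cos_gt0_pihalf//.
  by apply/andP; split; lra.
rewrite neq_lt => /orP[x0|x0].
- exists (- x * Num.sqrt (1 + (- y / - x) ^+ 2)), (atan (- y / - x) + pi).
  split.
  + by rewrite mulr_gt0 ?oppr_gt0// sqrtr_gt0 ltr_wpDr// sqr_ge0.
  + right; have := atan_gtNpi2 (- y / - x); have := atan_ltpi2 (- y / - x).
    by move=> h1 h2; apply/andP; split; lra.
  + have Nx0 : 0 < - x by rewrite oppr_gt0.
    have := xy_polar (- x) (- y) Nx0; rewrite !polarE cosDpi sinDpi => -[e1 e2].
    by rewrite !mulrN -e1 -e2 !opprK.
- exists (x * Num.sqrt (1 + (y / x) ^+ 2)), (atan (y / x)); split.
  + by rewrite mulr_gt0// sqrtr_gt0 ltr_wpDr// sqr_ge0.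
  + by left; rewrite atan_gtNpi2 atan_ltpi2.
  + exact: xy_polar.
Qed.

End complex_analysis.

(* The set (0, 2] \cup {0+, 1+}. *)
Inductive order_index (R : realType) : Type :=
| Pow (a : R) of 0 < a <= 2
| ZeroPlus
| OnePlus.
Arguments ZeroPlus {R}.
Arguments OnePlus {R}.

Section orders.
Context {R : realType}.

Lemma order_two_subproof : 0 < (2 : R) <= 2.
Proof. by rewrite ltr0n lexx. Qed.

Definition order_two : order_index R := Pow order_two_subproof.

Definition order_le (x y : order_index R) : bool :=
  match x, y with
  | Pow a _, Pow b _ => a <= b
  | Pow a _, OnePlus => a <= 1
  | Pow _ _, ZeroPlus => false
  | ZeroPlus, _ => true
  | OnePlus, Pow b _ => 1 < b
  | OnePlus, OnePlus => true
  | OnePlus, ZeroPlus => false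
  end.

Definition order_pow (rho : R) (nu : order_index R) : R :=
  match nu with
  | Pow a _ => rho `^ a
  | ZeroPlus => ln rho
  | OnePlus => rho * ln rho
  end.

End orders.

Section levy.
Context {R : realType} {d : measure_display} {Omega : measurableType d}.
Variable P : probability Omega R.
(* Only the values at times t >= 0 matter. *)
Implicit Type X : R -> {RV P >-> R}.

Definition independent_increments X : Prop :=
  forall (n : nat) (t : nat -> R), 0 <= t 0%N ->
    (forall i, (i < n)%N -> t i <= t i.+1) ->
  forall A : nat -> set R, (forall i, measurable (A i)) ->
    P [set w | forall i, (i < n)%N -> A i (X (t i.+1) w - X (t i) w)] =
    (\prod_(i < n) P [set w | A i (X (t i.+1) w - X (t i) w)%R])%E.

Definition stationary_increments X : Prop :=
  forall (s t : R), 0 <= s -> s <= t -> forall A : set R, measurable A ->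
    P [set w | A (X t w - X s w)] = P [set w | A (X (t - s) w)].

Definition stochastically_continuous X : Prop :=
  forall (s eps : R), 0 <= s -> 0 < eps ->
    P [set w | `|X t w - X s w| > eps] @[t --> within `[0, +oo[ (nbhs s)]
      --> 0%E.

Definition cadlag (x : R -> R) : Prop :=
  (forall t, 0 <= t -> x s @[s --> t^'+] --> x t) /\
  (forall t, 0 < t -> cvg (x s @[s --> t^'-])).

Definition levy_process X : Prop :=
  [/\ {ae P, forall w, X 0 w = 0},
      independent_increments X,
      stationary_increments X,
      stochastically_continuous X &
      {ae P, forall w, cadlag (fun t => X t w)}].

Definition characteristic_exponent X (psi : R -> R[i]) : Prop :=
  forall t xi : R, 0 <= t ->
    cintegral P (fun w => cexp ('i%C * (xi * X t w)%:C)) =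
    cexp (- (t%:C * psi xi)).

Definition levy_measure (F : {measure set R -> \bar R}) : Prop :=
  F [set 0] = 0%E /\ (\int[F]_x (Num.min 1 (x ^+ 2))%:E < +oo)%E.

(* psi^0, the part of the Levy-Khintchine formula left once the drift term
   - i mu xi is removed *)
Definition levy_khintchine0 (sigma2 : R) (F : {measure set R -> \bar R})
    (xi : R) : R[i] :=
  (sigma2 / 2 * xi ^+ 2)%:C +
  cintegral F (fun x : R => 1 - cexp ('i%C * (x * xi)%:C) +
                            'i%C * (x * xi * (`|x| <= 1)%R%:R)%:C).

Definition levy_khintchine (sigma2 mu : R) (F : {measure set R -> \bar R})
    (xi : R) : R[i] :=
  - ('i%C * (mu * xi)%:C) + levy_khintchine0 sigma2 F xi.

Definition generating_triplet X (sigma2 mu : R)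
    (F : {measure set R -> \bar R}) : Prop :=
  [/\ 0 <= sigma2, levy_measure F &
      characteristic_exponent X (levy_khintchine sigma2 mu F)].

Definition upper_growth (Psi : R[i] -> R[i]) (gm gp : R)
    (nu : order_index R) : Prop :=
  forall g1m g1p : R, gm < g1m < 0 -> 0 < g1p < gp ->
  exists C rho0 : R, [/\ 0 < C, 0 < rho0 &
    forall phi rho : R, g1m <= phi <= g1p -> rho0 < rho ->
      Normc.normc (Psi (polar rho phi)) <= C * order_pow rho nu].

Definition lower_growth (Psi : R[i] -> R[i]) (gm gp : R)
    (nu : order_index R) : Prop :=
  forall g1m g1p : R, gm < g1m -> g1m <= g1p -> g1p < gp ->
  exists c rho0 : R, [/\ 0 < c, 0 < rho0 &
    forall phi rho : R, g1m <= phi <= g1p -> rho0 < rho ->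
      c * order_pow rho nu <= complex.Re (Psi (polar rho phi))].

(* SINH-regularity of type ((mum, mup); C_{gm, gp}; C_{g'm, g'p}) and order
   (nu', nu).  The generating triplet is unique, so that the existential
   quantifier merely names psi^0 and the drift mu. *)
Definition SINH_regular X (mum mup gm gp g'm g'p : R)
    (nu' nu : order_index R) : Prop :=
  [/\ mum < 0 <= mup \/ mum <= 0 < mup,
      gm < 0 < gp,
      [/\ gm <= g'm <= 0, 0 <= g'p <= gp & 0 < `|g'm| + g'p] &
      exists (sigma2 mu : R) (F : {measure set R -> \bar R})
             (Psi0 : R[i] -> R[i]),
        let Psi z := - ('i%C * mu%:C * z) + Psi0 z in
        [/\ generating_triplet X sigma2 mu F,
            analytic_continuation (strip_cone mum mup gm gp)
              (levy_khintchine0 sigma2 F) Psi0,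
            upper_growth Psi gm gp nu &
            lower_growth Psi g'm g'p nu']].

End levy.

(* Measures on (0, +oo) are encoded as Borel measures on the real line that
   vanish on (-oo, 0]. *)
Section stieltjes_levy.
Context {R : realType}.
Implicit Types (G H : {measure set R -> \bar R}) (mu : R).

Definition SM mu G : Prop :=
  [/\ G `]-oo, 0]%classic = 0%E, G `]-oo, mu[%classic = 0%E &
      (\int[G]_(t in `]0%R, +oo[) ((1 + t)^-1)%:E < +oo)%E].

Definition SLM mu G : Prop :=
  G `]-oo, 0]%classic = 0%E /\
  exists a2 a1 : R, [/\ 0 <= a2, 0 <= a1, 0 < a2 + a1 &
    exists H, SM mu H /\
      forall A : set R, measurable A ->
        H A = (\int[G]_(t in A `&` `]0%R, +oo[)
                 ((a2 * t ^+ 2 + a1 * t)^-1)%:E)%E].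

Definition laplace G (x : R) : R := \int[G]_(t in `]0, +oo[) expR (- (t * x)).

(* An element G1 - G2 of sSLM_mu is represented by the pair (G1, G2), since
   G1 and G2 may both be infinite; its Laplace transform is [slaplace]. *)
Definition slaplace G1 G2 (x : R) : R := laplace G1 x - laplace G2 x.

Definition sSLM mu G1 G2 : Prop :=
  [/\ SLM mu G1, SLM mu G2 & forall x, 0 < x -> 0 <= slaplace G1 G2 x].

Definition has_levy_density (F : {measure set R -> \bar R}) (f : R -> R) :
    Prop :=
  forall A : set R, measurable A ->
    F A = (\int[lebesgue_measure]_(x in A) (f x)%:E)%E.

Definition sSL d (Omega : measurableType d) (P : probability Omega R)
    (mum mup : R) (X : R -> {RV P >-> R}) : Prop :=
  exists (sigma2 mu : R) (F Gm1 Gm2 Gp1 Gp2 : {measure set R -> \bar R}),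
    [/\ generating_triplet X sigma2 mu F,
        sSLM mup Gm1 Gm2, sSLM (- mum) Gp1 Gp2 &
        has_levy_density F
          (fun x => \1_`]-oo, 0[ x * slaplace Gm1 Gm2 (- x) +
                    \1_`]0, +oo[ x * slaplace Gp1 Gp2 x)].

End stieltjes_levy.

(* Main.v *)
(* The Levy density is, on each half-axis, a difference of Laplace transforms of
   measures; let G be one of them.  It lives on a
   half-line t >= m, integrable against 1 / (t (1 + t)^2).  Replace the truncation
   x 1_{|x| <= 1} in the Levy-Khintchine kernel by the odd extension of 1 - e^{-x},
   which only changes the drift, by a real constant E.  For real xi, Fubini then
   evaluates the contribution of G as
     int (1/t - 1/(t - i xi) + i xi (1/t - 1/(1 + t))) G(dt) = - u (1 + u) S_G(u),
   where u = i xi and S_G(u) = int G(dt) / (t (1 + t) (t - u)); the negative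
   half-axis contributes the same expression at u = - i xi.  The transform S_G is
   holomorphic off [m, +oo), hence psi^0 continues to C minus the two cuts, and
   |t - u| >= c (1 + t) holds with a constant c uniform in a closed subsector of
   the right half-plane, which bounds S_G there and gives psi(xi) = O(|xi|^2): the
   order nu = 2 always works. *)

Require Import Defs.
From HB Require Import structures.
From mathcomp Require Import all_boot all_order all_algebra.
From mathcomp Require Import complex ring lra.
From mathcomp Require Import all_classical all_reals all_analysis.
From mathcomp Require Import measurable_realfun.
Import Order.TTheory GRing.Theory Num.Theory.
Import numFieldNormedType.Exports.
Local Open Scope classical_set_scope.
Local Open Scope ring_scope.

(** * Measures with a density *)

(** On each half-axis both measures of the pair may be infinite, and only the difference of their
    Laplace transforms is known to be nonnegative. Fubini therefore runs on each of the four
    measures separately, under an absolute bound, and the differences are formed afterwards. The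
    common majorant is C (1 - e^{-x})^2: it has the size of min(1, x^2), and its Laplace transform
    2C / (t (1 + t) (2 + t)) is at most 2C times the weight 1 / (t (1 + t)^2). A kernel must thus be
    bounded and vanish to second order at 0, which the sine part does only after compensation. The
    compensator 1 - e^{-x} has the rational transform 1/t - 1/(1 + t), so that the integrand
    collapses to a single fraction; a sharp cutoff would leave exponentials in t. Holomorphy of S_G
    comes from a second-order remainder bound for the resolvent, integrated as it stands, so that no
    limit has to be exchanged with an integral. The given exponent is known only through e^{-t psi};
    letting t range over all nonnegative reals removes the 2 pi i ambiguity and identifies it with
    the Levy-Khintchine formula. *)

Section density.
Context d (T : measurableType d) (R : realType).
Variables (M N : {measure set T -> \bar R}) (g : T -> R).
Hypotheses (g0 : forall x, 0 <= g x) (mg : measurable_fun setT g).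
Hypothesis MN : forall A, measurable A ->
  M A = (\int[N]_(x in A) (g x)%:E)%E.

Import HBNNSimple.
Local Open Scope ereal_scope.

Let nnsfun_density (h : {nnsfun T >-> R}) :
  \int[M]_x (h x)%:E = \int[N]_x ((h x)%:E * (g x)%:E).
Proof.
have mh (r : R) : measurable_fun setT (fun x => (r * \1_(h @^-1` [set r]) x)%:E).
  by apply/measurable_EFinP; exact: measurable_funM.
have mG : measurable_fun setT (EFin \o g) by exact/measurable_EFinP.
under eq_integral do rewrite fimfunE -fsumEFin//.
rewrite ge0_integral_fsum//; last by move=> r x _; exact: nnfun_muleindic_ge0.
transitivity (\int[N]_x (\sum_(r \in range h)
    ((r * \1_(h @^-1` [set r]) x)%:E * (g x)%:E))).
  rewrite ge0_integral_fsum//; last 2 first.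
  - by move=> r; exact: emeasurable_funM.
  - by move=> r x _; rewrite mule_ge0 ?lee_fin// -lee_fin nnfun_muleindic_ge0.
  apply: eq_fsbigr => r rh; have r0 : (0 <= r)%R.
    by move: rh; rewrite inE => -[t _ <-].
  under eq_integral do rewrite EFinM.
  rewrite integralZl_indic_nnsfun// integral_indic// setIT MN//.
  under [RHS]eq_integral do rewrite EFinM -muleA.
  rewrite ge0_integralZl//.
  - congr (_ * _); rewrite integral_mkcond.
    by apply: eq_integral => x _; rewrite patchE indicE; case: ifP => _; rewrite ?mul1e ?mul0e.
  - by apply: emeasurable_funM => //; exact/measurable_EFinP.
  - by move=> x _; rewrite mule_ge0// lee_fin.
apply: eq_integral => x _; rewrite -ge0_mule_fsuml; last first.
  by move=> r; exact: nnfun_muleindic_ge0.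
by rewrite fsumEFin// -fimfunE.
Qed.

(** Monotone convergence along simple functions reduces this to [nnsfun_density]. The density is
    given by its values on sets, without any finiteness of [M] or [N], so nothing of Radon-Nikodym
    type is involved. *)
Lemma ge0_integral_density (f : T -> \bar R) : measurable_fun setT f ->
  (forall x, 0 <= f x) -> \int[M]_x f x = \int[N]_x (f x * (g x)%:E).
Proof.
move=> mf f0; pose h := nnsfun_approx measurableT mf.
have hf x : (h n x)%:E @[n --> \oo] --> f x.
  by apply: (cvg_nnsfun_approx measurableT mf) => //.
have -> : \int[M]_x f x = lim (\int[M]_x (h n x)%:E @[n --> \oo]).
  under eq_integral => x _ do rewrite -(cvg_lim _ (hf x))//.
  apply: monotone_convergence => //.
  - by move=> n; exact/measurable_EFinP.
  - by move=> n x _; rewrite lee_fin.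
  - by move=> x _ a b ab; rewrite lee_fin; exact/lefP/nd_nnsfun_approx.
have hfg x : (h n x)%:E * (g x)%:E @[n --> \oo] --> f x * (g x)%:E.
  by apply: cvgeZr => //; exact: hf.
under [RHS]eq_integral => x _ do rewrite -(cvg_lim _ (hfg x))//.
rewrite monotone_convergence//.
- by under eq_fun do rewrite nnsfun_density.
- by move=> n; apply: emeasurable_funM; exact/measurable_EFinP.
- by move=> n x _; rewrite mule_ge0// lee_fin.
- move=> x _ a b ab; rewrite lee_wpmul2r ?lee_fin//.
  exact/lefP/nd_nnsfun_approx.
Qed.

(** Multiplication by the nonnegative [g] commutes with taking positive and negative parts, so each
    part falls under [ge0_integral_density]. *)
Lemma integrable_density (q : T -> R) : measurable_fun setT q ->
  N.-integrable setT (fun x => (q x * g x)%:E) ->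
  M.-integrable setT (EFin \o q) /\
  \int[M]_x (q x)%:E = \int[N]_x (q x * g x)%:E.
Proof.
move=> mq iqg.
have pn (e : T -> \bar R) : (forall x, 0 <= e x) -> measurable_fun setT e ->
  \int[M]_x e x = \int[N]_x (e x * (g x)%:E) by move=> *; exact: ge0_integral_density.
split.
  apply/integrableP; split; first exact/measurable_EFinP.
  rewrite pn//; last by apply: measurableT_comp => //; exact/measurable_EFinP.
  move/integrableP : iqg => [_]; apply: le_lt_trans.
  rewrite le_eqVlt; apply/orP; left; apply/eqP.
  by apply: eq_integral => x _; rewrite /= normrM EFinM (ger0_norm (g0 x)).
rewrite integralE [RHS]integralE; congr (_ - _).
- rewrite pn//; last by apply: measurable_funepos; exact/measurable_EFinP.
  apply: eq_integral => x _; rewrite !funeposE -!EFin_max -EFinM.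
  by rewrite maxr_pMl// mul0r.
- rewrite pn//; last by apply: measurable_funeneg; exact/measurable_EFinP.
  apply: eq_integral => x _; rewrite !funenegE -!EFinN -!EFin_max -EFinM.
  by rewrite maxr_pMl// mul0r mulNr.
Qed.

End density.
(** * Complex integrals and derivatives *)

Section complex_norm.
Context {R : realType}.
Implicit Types z w : R[i].
Local Notation normc := (@Normc.normc R).

Lemma normcE_real z : `|z| = (normc z)%:C%C.
Proof. by case: z => x y; rewrite normc_def. Qed.

Lemma normc_ge0 z : 0 <= normc z.
Proof. by case: z => x y; exact: sqrtr_ge0. Qed.

Lemma ler_normcD z w : normc (z + w) <= normc z + normc w.
Proof. by have := ler_normD z w; rewrite !normcE_real -rmorphD lecR. Qed.

Lemma ler_normcB z w : normc z - normc w <= normc (z - w).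
Proof. by have := lerB_dist z w; rewrite !normcE_real -rmorphB lecR. Qed.

Lemma normcN_real z : normc (- z) = normc z.
Proof. by case: z => x y /=; rewrite !sqrrN. Qed.

Lemma normc_real (x : R) : normc x%:C%C = `|x|.
Proof. by rewrite /= expr0n addr0 sqrtr_sqr. Qed.

Lemma Re_le_normc z : `|complex.Re z| <= normc z.
Proof. by rewrite -lecR -normcE_real normc_ge_Re. Qed.

Lemma Im_le_normc z : `|complex.Im z| <= normc z.
Proof.
case: z => x y /=; rewrite -[leLHS]sqrtr_sqr ler_wsqrtr//.
by rewrite lerDr sqr_ge0.
Qed.

Lemma normc_le_ReIm z : normc z <= `|complex.Re z| + `|complex.Im z|.
Proof.
rewrite [z in normc z]complexE (le_trans (ler_normcD _ _))// Normc.normcM.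
by rewrite !normc_real /= expr0n expr1n add0r sqrtr1 mul1r.
Qed.

Lemma normcXn z n : normc (z ^+ n) = normc z ^+ n.
Proof.
elim: n => [|n IH]; first by rewrite !expr0 Normc.normc1.
by rewrite !exprS Normc.normcM IH.
Qed.

End complex_norm.

Lemma measurable_invr (R : realType) : measurable_fun [set: R] (@GRing.inv R).
Proof.
have -> : [set: R] = [set 0] `|` ~` [set 0] by rewrite setUv.
apply/measurable_funU => //; first exact: measurableC.
split; first exact: measurable_fun_set1.
apply: open_continuous_measurable_fun.
  exact/closed_openC/accessible_closed_set1/hausdorff_accessible.
by move=> x; rewrite inE => /eqP x0; exact: inv_continuous.
Qed.

Lemma measurable_fun_invr d (T : measurableType d) (R : realType) (f : T -> R) :
  measurable_fun setT f -> measurable_fun setT (fun x => (f x)^-1).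
Proof. by move=> mf; apply: (measurableT_comp (@measurable_invr R)). Qed.

Section complex_integral.
Context d (T : measurableType d) (R : realType) (m : {measure set T -> \bar R}).
Implicit Types f g : T -> R[i].
Local Notation normc := (@Normc.normc R).

Definition cmeasurable f :=
  measurable_fun setT (fun x => complex.Re (f x)) /\
  measurable_fun setT (fun x => complex.Im (f x)).

Definition cintegrable f :=
  m.-integrable setT (fun x => (complex.Re (f x))%:E) /\
  m.-integrable setT (fun x => (complex.Im (f x))%:E).

Lemma cmeasurable_real (f : T -> R) :
  measurable_fun setT f -> cmeasurable (fun x => (f x)%:C%C).
Proof. by move=> mf; split. Qed.

Lemma cmeasurable_cst (z : R[i]) : cmeasurable (fun=> z).
Proof. by split; exact: measurable_cst. Qed.

Lemma cmeasurableB f g : cmeasurable f -> cmeasurable g ->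
  cmeasurable (fun x => f x - g x).
Proof.
move=> [fR fI] [gR gI]; split.
  apply: (eq_measurable_fun (fun x => complex.Re (f x) - complex.Re (g x))).
    by move=> x _; case: (f x) (g x) => [? ?] [? ?].
  exact: measurable_funB.
apply: (eq_measurable_fun (fun x => complex.Im (f x) - complex.Im (g x))).
  by move=> x _; case: (f x) (g x) => [? ?] [? ?].
exact: measurable_funB.
Qed.

Lemma cmeasurableM f g : cmeasurable f -> cmeasurable g ->
  cmeasurable (fun x => f x * g x).
Proof.
move=> [fR fI] [gR gI]; split.
  apply: (eq_measurable_fun (fun x =>
      complex.Re (f x) * complex.Re (g x) - complex.Im (f x) * complex.Im (g x))).
    by move=> x _; case: (f x) (g x) => [? ?] [? ?].
  by apply: measurable_funB; exact: measurable_funM.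
apply: (eq_measurable_fun (fun x =>
    complex.Re (f x) * complex.Im (g x) + complex.Im (f x) * complex.Re (g x))).
  by move=> x _; case: (f x) (g x) => [? ?] [? ?].
by apply: measurable_funD; exact: measurable_funM.
Qed.

Lemma cmeasurableV f : cmeasurable f -> cmeasurable (fun x => (f x)^-1).
Proof.
move=> [fR fI]; have mn : measurable_fun setT
    (fun x => (complex.Re (f x) ^+ 2 + complex.Im (f x) ^+ 2)^-1).
  by apply: measurable_fun_invr; apply: measurable_funD; exact: measurable_funX.
split.
  apply: (eq_measurable_fun (fun x => complex.Re (f x) *
      (complex.Re (f x) ^+ 2 + complex.Im (f x) ^+ 2)^-1)).
    by move=> x _; case: (f x) => [? ?].
  exact: measurable_funM.
apply: (eq_measurable_fun (fun x => - (complex.Im (f x) *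
    (complex.Re (f x) ^+ 2 + complex.Im (f x) ^+ 2)^-1))).
  by move=> x _; case: (f x) => [? ?].
by apply: measurableT_comp => //; exact: measurable_funM.
Qed.

Lemma cintegralB f g : cintegrable f -> cintegrable g ->
  cintegral m (fun x => f x - g x) = cintegral m f - cintegral m g.
Proof.
move=> [fR fI] [gR gI]; rewrite /cintegral.
transitivity ((Rintegral m setT (fun x => complex.Re (f x) - complex.Re (g x)))
   +i* (Rintegral m setT (fun x => complex.Im (f x) - complex.Im (g x))))%C.
  by congr (_ +i* _)%C; apply: eq_Rintegral => x _;
    case: (f x) (g x) => [? ?] [? ?].
by rewrite !RintegralB.
Qed.

Lemma cintegralZl (z : R[i]) f : cintegrable f ->
  cintegral m (fun x => z * f x) = z * cintegral m f.
Proof.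
case: z => a b [fR fI]; rewrite /cintegral.
have iZ (k : R) (h : T -> R) : m.-integrable setT (fun x => (h x)%:E) ->
    m.-integrable setT (fun x => (k * h x)%:E).
  by move=> ih; under eq_fun do rewrite EFinM; exact: integrableZl.
transitivity ((Rintegral m setT (fun x => a * complex.Re (f x) - b * complex.Im (f x)))
   +i* (Rintegral m setT (fun x => a * complex.Im (f x) + b * complex.Re (f x))))%C.
  by congr (_ +i* _)%C; apply: eq_Rintegral => x _; case: (f x) => [? ?].
by rewrite RintegralB ?RintegralD ?RintegralZl//; exact: iZ.
Qed.

(** The factor 2 is the price of bounding real and imaginary parts separately; sharp constants do
    not matter for holomorphy or for the growth order. *)
Lemma normc_cintegral_le f (g : T -> R) : cmeasurable f ->
  m.-integrable setT (fun x => (g x)%:E) -> (forall x, normc (f x) <= g x) ->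
  cintegrable f /\ normc (cintegral m f) <= 2 * Rintegral m setT g.
Proof.
move=> [fR fI] ig fg.
have iR : m.-integrable setT (fun x => (complex.Re (f x))%:E).
  apply: (le_integrable _ _ _ ig) => //; first exact/measurable_EFinP.
  move=> x _; rewrite lee_fin (le_trans (Re_le_normc _))//.
  by rewrite (le_trans (fg x))// ler_norm.
have iI : m.-integrable setT (fun x => (complex.Im (f x))%:E).
  apply: (le_integrable _ _ _ ig) => //; first exact/measurable_EFinP.
  move=> x _; rewrite lee_fin (le_trans (Im_le_normc _))//.
  by rewrite (le_trans (fg x))// ler_norm.
split; first by split.
have le1 (h : T -> R) : m.-integrable setT (fun x => (h x)%:E) ->
    (forall x, `|h x| <= normc (f x)) -> `|Rintegral m setT h| <= Rintegral m setT g.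
  move=> ih hf; apply: (le_trans (le_normr_Rintegral _ ih)) => //.
  apply: le_Rintegral => //; first exact: integrable_norm.
  by move=> x _; rewrite (le_trans (hf x)).
rewrite (le_trans (normc_le_ReIm _))// mulr_natl mulr2n.
by apply: lerD; apply: le1 => // x; [exact: Re_le_normc|exact: Im_le_normc].
Qed.

End complex_integral.
Arguments cmeasurable {d T R} f.
Arguments cintegrable {d T R} m f.

Section complex_derivative.
Context {R : realType}.
Local Notation normc := (@Normc.normc R).

(** After division by [h] the remainder is O(|h|), hence tends to 0: a quadratic remainder bound
    yields the derivative [L]. *)
Lemma derivable_quadratic (f : R[i] -> R[i]) (z L : R[i]) (c K : R) :
  0 < c ->
  (forall h, normc h <= c -> normc (f (z + h) - f z - h * L) <= K * normc h ^+ 2) ->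
  derivable (f : R[i]^o -> R[i]^o) z 1.
Proof.
move=> c0 fL; apply/cvg_ex; exists L => /=.
apply/cvgrPdist_le => e e0.
(* In the partial order of [R[i]], a positive element has zero imaginary part. *)
have [e1 e1E] : exists e1 : R, e = e1%:C%C.
  by exists (complex.Re e); case: e e0 => x y; rewrite ltcE /= => /andP[/eqP-> _].
move: e0; rewrite {}e1E ltcR => e0.
have K1 : 0 < `|K| + 1 by rewrite ltr_pwDr.
pose r := Num.min c (e1 / (`|K| + 1)).
have r0 : 0 < r by rewrite lt_min c0 divr_gt0.
have r0' : 0 < r%:C%C :> R[i] by rewrite ltcR.
near=> h.
have h0 : h != 0.
  near: h; exact: (@nbhs_dnbhs_neq R[i]^o).
have hr : normc h <= r.
  rewrite -lecR -normcE_real; near: h; exact: (@dnbhs0_le _ R[i]^o _ r0').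
have nh0 : 0 < normc h.
  by rewrite -ltcR -normcE_real normr_gt0.
have := fL h; rewrite (le_trans hr) ?ge_min ?lexx// => /(_ isT) le1.
rewrite -normrN opprB normcE_real lecR.
have -> : h^-1 *: (f (h *: (1 : R[i]^o) + z) - f z) - L =
          h^-1 * (f (z + h) - f z - h * L).
  rewrite /GRing.scale/= mulr1 (addrC h z) [in RHS]mulrBr mulrA mulVf// mul1r.
  by [].
rewrite Normc.normcM Normc.normcV mulrC ler_pdivrMr//.
apply: (le_trans le1); rewrite expr2 mulrA ler_pM2r//.
apply: (@le_trans _ _ ((`|K| + 1) * normc h)).
  by rewrite ler_pM2r// (le_trans (ler_norm K))// lerDl.
by rewrite mulrC -ler_pdivlMr// (le_trans hr)// ge_min lexx orbT.
Unshelve. all: by end_near. Qed.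

End complex_derivative.
(** * Kernel bounds and Laplace transforms *)

Section trigonometric_bounds.
Context {R : realType}.
Implicit Types u x xi : R.

Let abs_odd (f g : R -> R) : (forall u, f (- u) = - f u) ->
  (forall u, g (- u) = g u) -> f 0 = 0 -> 0 <= g 0 ->
  (forall u, 0 < u -> `|f u| <= g u) -> forall u, `|f u| <= g u.
Proof.
move=> fN gN f0 g0 fg u; have [u0|u0|<-] := ltgtP 0 u; first exact: fg.
  by rewrite -(opprK u) fN gN normrN fg// oppr_gt0.
by rewrite f0 normr0.
Qed.

Lemma normr_sin_le u : `|sin u| <= `|u|.
Proof.
apply: (abs_odd sin (fun u => `|u|)) => {u} //; first exact: sinN.
- exact: normrN.
- exact: sin0.
move=> u u0; have [|c _] := @MVT R sin cos 0 u u0.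
  by apply: continuous_subspaceT; exact: continuous_sin.
rewrite sin0 !subr0 => ->; rewrite normrM ler_piMl// ler_norml.
by rewrite cos_geN1 cos_le1.
Qed.

Lemma onem_cosE u : 1 - cos u = 2 * sin (u / 2) ^+ 2.
Proof.
rewrite [in cos u](_ : u = u / 2 + u / 2); last by rewrite -splitr.
by rewrite cosD -!expr2 cos2sin2; ring.
Qed.

Lemma onem_cos_le_sqr u : 1 - cos u <= u ^+ 2.
Proof.
have h : sin (u / 2) ^+ 2 <= (u / 2) ^+ 2.
  rewrite -[leLHS]real_normK ?num_real// -[leRHS]real_normK ?num_real//.
  by rewrite lerXn2r ?nnegrE// normr_sin_le.
have := sqr_ge0 u; rewrite onem_cosE; move: h; rewrite exprMn => h; lra.
Qed.

Lemma onem_cos_le u : 1 - cos u <= `|u|.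
Proof.
rewrite onem_cosE -[sin (u / 2) ^+ 2]real_normK ?num_real//.
have s1 : `|sin (u / 2)| <= 1 by exact: sin_max.
have := normr_sin_le (u / 2); rewrite normrM (ger0_norm (_ : 0 <= 2^-1))//.
have := normr_ge0 (sin (u / 2)); nra.
Qed.

(** By the mean value theorem u - sin u = (1 - cos c) u with 0 < c < u, and 1 - cos c <= c. Second
    order is all that the majorant requires. *)
Lemma subr_sin_le u : `|u - sin u| <= u ^+ 2.
Proof.
apply: (abs_odd (fun u => u - sin u) (fun u => u ^+ 2)) => {u}.
- by move=> u; rewrite sinN opprD.
- by move=> u; rewrite sqrrN.
- by rewrite sin0 subr0.
- by rewrite expr0n.
move=> u u0; have [|c] := @MVT R sin cos 0 u u0.
  by apply: continuous_subspaceT; exact: continuous_sin.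
rewrite in_itv/= => /andP[c0 cu]; rewrite sin0 !subr0 => ->.
have := onem_cos_le c; rewrite (gtr0_norm c0) => c1.
have := cos_le1 c => c2.
rewrite (_ : u - cos c * u = (1 - cos c) * u); last ring.
rewrite ger0_norm; last by rewrite mulr_ge0// ?subr_ge0// ltW.
by rewrite expr2 ler_pM2r// (le_trans c1)// ltW.
Qed.

Lemma onem_expR_ge x : 0 < x -> x / (1 + x) <= 1 - expR (- x).
Proof.
move=> x0; have x1 : 0 < 1 + x by rewrite addr_gt0.
rewrite (_ : x / (1 + x) = 1 - (1 + x)^-1); last by field; rewrite gt_eqF.
by rewrite lerB// expRN lef_pV2 ?posrE ?expR_gt0// expR_ge1Dx.
Qed.

Lemma onem_expR_le x : 1 - expR (- x) <= x.
Proof. by have := expR_ge1Dx (- x); lra. Qed.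

Lemma subr_onem_expR_le x : 0 < x -> `|x - (1 - expR (- x))| <= x ^+ 2.
Proof.
move=> x0; rewrite ger0_norm ?subr_ge0 ?onem_expR_le//.
apply: (@le_trans _ _ (x - x / (1 + x))); first by rewrite lerB// onem_expR_ge.
rewrite (_ : x - x / (1 + x) = x ^+ 2 / (1 + x)); last first.
  by field; rewrite gt_eqF// addr_gt0.
by rewrite ler_pdivrMr ?addr_gt0// ler_peMr ?sqr_ge0// lerDl ltW.
Qed.

(** With e = 1 - e^{-x} >= x / (1 + x), one has x <= 2 e on ]0, 1] and 1 <= 2 e beyond 1; squaring
    gives the 4. This turns a bound of type min(1, x^2) into one whose Laplace transform is
    rational. *)
Lemma le_onem_expR_sqr (q : R -> R) (A B : R) : 0 <= A -> 0 <= B ->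
  (forall x, 0 < x <= 1 -> `|q x| <= A * x ^+ 2) ->
  (forall x, 1 < x -> `|q x| <= B) ->
  forall x, 0 < x -> `|q x| <= 4 * (A + B) * (1 - expR (- x)) ^+ 2.
Proof.
move=> A0 B0 qA qB x x0; have := onem_expR_ge _ x0.
set e := 1 - expR (- x) => ex; have e0 : 0 < e.
  by apply: lt_le_trans ex; rewrite divr_gt0// addr_gt0.
move: ex; rewrite ler_pdivrMr ?addr_gt0// => ex.
have [x1|x1] := leP x 1.
  apply: (le_trans (qA _ _)); first by rewrite x0 x1.
  have xe : x <= 2 * e by nra.
  have : x ^+ 2 <= (2 * e) ^+ 2 by rewrite lerXn2r// nnegrE; lra.
  rewrite exprMn => xe2; have : 0 <= e ^+ 2 by exact: sqr_ge0.
  by nra.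
apply: (le_trans (qB _ x1)).
have e2 : 1 <= 2 * e by nra.
have : 1 <= 4 * e ^+ 2 by nra.
by nra.
Qed.

Lemma onem_cos_domination xi x : 0 < x ->
  `|1 - cos (x * xi)| <= 4 * (xi ^+ 2 + 2) * (1 - expR (- x)) ^+ 2.
Proof.
apply: (@le_onem_expR_sqr (fun x => 1 - cos (x * xi))) => {x}; rewrite ?sqr_ge0//.
  move=> x /andP[x0 x1]; rewrite ger0_norm ?subr_ge0 ?cos_le1//.
  by rewrite -exprMn mulrC onem_cos_le_sqr.
move=> x x1; rewrite ger0_norm ?subr_ge0 ?cos_le1//.
by have := cos_geN1 (x * xi); lra.
Qed.

Lemma sin_domination xi x : 0 < x ->
  `|- sin (x * xi) + xi * (1 - expR (- x))| <=
  4 * (xi ^+ 2 + `|xi| + (1 + `|xi|)) * (1 - expR (- x)) ^+ 2.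
Proof.
apply: (@le_onem_expR_sqr (fun x => - sin (x * xi) + xi * (1 - expR (- x)))) => {x}.
- by rewrite addr_ge0// sqr_ge0.
- by rewrite addr_ge0.
- move=> x /andP[x0 x1].
  (* The first-order terms in [x] cancel between the sine and its compensator; both brackets are
     O(x^2). *)
  rewrite (_ : - sin (x * xi) + _ =
    (x * xi - sin (x * xi)) - xi * (x - (1 - expR (- x)))); last ring.
  rewrite (le_trans (ler_normB _ _))// mulrDl lerD//.
    by rewrite -exprMn mulrC subr_sin_le.
  by rewrite normrM ler_wpM2l// subr_onem_expR_le.
- move=> x x1; rewrite (le_trans (ler_normD _ _))// normrN lerD ?sin_max//.
  rewrite normrM ler_piMr// ger0_norm.
    by rewrite lerBlDr lerDl ltW// expR_gt0.
  by rewrite subr_ge0 -expR0 ler_expR; lra.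
Qed.

Lemma truncation_domination x : 0 < x ->
  `|x * (`|x| <= 1)%R%:R - (1 - expR (- x))| <= 4 * (1 + 1) * (1 - expR (- x)) ^+ 2.
Proof.
apply: (@le_onem_expR_sqr (fun x => x * (`|x| <= 1)%R%:R - (1 - expR (- x)))) => {x}//.
  move=> x /andP[x0 x1]; rewrite (gtr0_norm x0) x1 mulr1 mul1r.
  exact: subr_onem_expR_le.
move=> x x1; have x0 : 0 < x by lra.
rewrite (gtr0_norm x0) [x <= 1]leNgt x1 mulr0 sub0r normrN ger0_norm.
  by rewrite lerBlDr lerDl ltW// expR_gt0.
by rewrite subr_ge0 -expR0 ler_expR; lra.
Qed.

End trigonometric_bounds.

Section laplace_transforms.
Context {R : realType}.
Implicit Types (q : R -> R) (t r xi : R).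
Local Notation leb := (@lebesgue_measure R).

(** [Rintegral] sends an infinite integral to 0, so the value is meaningful only together with
    integrability. *)
Definition has_laplace q t r :=
  leb.-integrable `]0, +oo[ (fun x => (q x * expR (- (t * x)))%:E) /\
  Rintegral leb `]0, +oo[ (fun x => q x * expR (- (t * x))) = r.

Lemma has_laplaceB q1 q2 t r1 r2 : has_laplace q1 t r1 -> has_laplace q2 t r2 ->
  has_laplace (fun x => q1 x - q2 x) t (r1 - r2).
Proof.
move=> [i1 <-] [i2 <-]; split.
  apply: (eq_integrable _ _ _ _ (integrableB _ i1 i2)) => // x _.
  by rewrite mulrBl EFinB.
by rewrite -RintegralB//; apply: eq_Rintegral => x _; rewrite mulrBl.
Qed.

Lemma has_laplaceZ k q t r : has_laplace q t r ->
  has_laplace (fun x => k * q x) t (k * r).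
Proof.
move=> [i <-]; split.
  apply: (eq_integrable _ _ _ _ (integrableZl _ k i)) => // x _.
  by rewrite -mulrA EFinM.
by rewrite -RintegralZl//; apply: eq_Rintegral => x _; rewrite mulrA.
Qed.

(** For a nonnegative integrand the fundamental theorem on the half-line gives the value and, since
    that value is finite, integrability as well. This is why the elementary kernels below are the
    nonnegative 1 - cos and 1 - sin. *)
Lemma has_laplace_FTC (q F : R -> R) t : (forall x, 0 <= x -> 0 <= q x) ->
  continuous q ->
  (forall x : R, is_derive x 1 F (q x * expR (- (t * x)))) ->
  F x @[x --> +oo] --> 0 -> has_laplace q t (- F 0).
Proof.
move=> q0 cq dF Foo; pose f x := q x * expR (- (t * x)).
have cf : continuous f.
  move=> x; apply: cvgM; first exact: cq.
  apply: (@continuous_comp _ _ _ (fun x => - (t * x)) expR).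
    by apply: cvgN; apply: cvgMr; exact: cvg_id.
  exact: continuous_expR.
have f0 x : 0 <= x -> 0 <= f x by move=> x0; rewrite mulr_ge0// ?q0// expR_ge0.
have mf : measurable_fun setT f.
  by apply: (open_continuous_measurable_fun openT) => x _; exact: cf.
have If : (\int[leb]_(x in `]0%R, +oo[) (f x)%:E = 0%:E - (F 0)%:E)%E.
  rewrite integral_itv_obnd_cbnd; last exact/measurable_EFinP/measurable_funTS.
  apply: ge0_continuous_FTC2y => //.
  - exact: continuous_subspaceT.
  - apply: cvg_at_right_filter; apply: differentiable_continuous.
    by apply/derivable1_diffP; have [] := dF 0.
  - by move=> x _; rewrite derive1E; have [_ ->] := dF x.
split; last by rewrite /Rintegral If/= sub0r.
apply/integrableP; split; first exact/measurable_EFinP/measurable_funTS.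
under eq_integral => x.
  rewrite inE/= in_itv/= andbT => x0; rewrite ger0_norm; last by rewrite f0// ltW.
  over.
by rewrite If ltry.
Qed.

Let cvg_expRM t (g : R -> R) (M : R) : 0 < t -> (forall x, `|g x| <= M) ->
  expR (- (t * x)) * g x @[x --> +oo] --> 0.
Proof.
move=> t0 gM.
have e0 : expR (- (t * x)) @[x --> +oo] --> 0.
  apply: (@cvg_comp _ _ _ (fun x => t * x) (fun x => expR (- x))); last first.
    exact: cvgr_expR.
  by apply: gt0_cvgMry => //; exact: cvg_id.
have eM k : k * expR (- (t * x)) @[x --> +oo] --> 0.
  by rewrite -(mulr0 k); apply: cvgMr.
apply: (squeeze_cvgr _ (eM (- M)) (eM M)).
apply: nearW => x; have := gM x; rewrite ler_norml => /andP[h1 h2].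
by rewrite !(mulrC _ (expR _)) !ler_pM2l ?expR_gt0// h1 h2.
Qed.

Let is_derive_expRM t (g : R -> R) (x dg : R) : is_derive x 1 g dg ->
  is_derive x 1 (fun x => expR (- (t * x)) * g x)
    (expR (- (t * x)) * (dg - t * g x)).
Proof.
move=> dgx; have de : is_derive x 1 (fun x => expR (- (t * x)))
    (expR (- (t * x)) * - t).
  apply: (@is_derive1_comp _ expR (fun x => - (t * x))).
  apply: (is_derive_eq (is_deriveN (is_deriveZ t (is_derive_id x (1 : R))))).
  by rewrite /GRing.scale/= mulr1.
apply: (is_derive_eq (is_deriveM de dgx)).
by rewrite /GRing.scale/=; ring.
Qed.

Let is_derive_scaled (f df : R -> R) (xi x : R) : (forall y : R, is_derive y 1 f (df y)) ->
  is_derive x 1 (fun x => f (x * xi)) (df (x * xi) * xi).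
Proof.
move=> dfy; apply: (@is_derive1_comp _ f (fun x => x * xi)).
rewrite (_ : (fun x => x * xi) = xi \*: id); last first.
  by apply/funext => y; rewrite /GRing.scale/= mulrC.
apply: (is_derive_eq (is_deriveZ xi (is_derive_id x (1 : R)))).
by rewrite /GRing.scale/= mulr1.
Qed.

Lemma has_laplace_expR s t : 0 < s + t ->
  has_laplace (fun x => expR (- (s * x))) t (s + t)^-1.
Proof.
move=> st.
suff : has_laplace (fun=> 1) (s + t) (s + t)^-1.
  move=> [i e]; split.
    apply: (eq_integrable _ _ _ _ i) => // x _.
    by rewrite mul1r mulrDl opprD expRD.
  by rewrite -e; apply: eq_Rintegral => x _; rewrite mul1r mulrDl opprD expRD.
rewrite -[in X in has_laplace _ _ X](opprK (s + t)^-1).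
have := @has_laplace_FTC (fun=> 1) (fun x => expR (- ((s + t) * x)) * - (s + t)^-1)
  (s + t).
rewrite mulr0 oppr0 expR0 mul1r; apply => //.
- by move=> x; exact: cst_continuous.
- move=> x; apply: (is_derive_eq (is_derive_expRM (s + t) (fun=> - (s + t)^-1) x 0
    (is_derive_cst (- (s + t)^-1) x 1))).
  by field; rewrite gt_eqF.
- apply: (cvg_expRM _ _ (`|(s + t)^-1|)) => // x.
  by rewrite normrN.
Qed.

Lemma has_laplace_onem_cos xi t : 0 < t ->
  has_laplace (fun x => 1 - cos (x * xi)) t (t^-1 - t / (t ^+ 2 + xi ^+ 2)).
Proof.
move=> t0; have n0 : 0 < t ^+ 2 + xi ^+ 2.
  by rewrite ltr_pwDl ?sqr_ge0// exprn_gt0.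
(* The first term is the real part of e^{i x xi} / (t - i xi); multiplied by e^{-t x} it is an
   antiderivative of - e^{-t x} cos (x xi). *)
pose g x := (t ^+ 2 + xi ^+ 2)^-1 * (t * cos (x * xi) - xi * sin (x * xi)) - t^-1.
have -> : t^-1 - t / (t ^+ 2 + xi ^+ 2) = - (expR (- (t * 0)) * g 0).
  by rewrite /g mulr0 oppr0 expR0 mul0r cos0 sin0; field; rewrite !gt_eqF.
have ccos : continuous (fun x : R => cos (x * xi)).
  move=> x; apply: (@continuous_comp _ _ _ (fun x : R => x * xi) cos).
    by apply: cvgMl; exact: cvg_id.
  exact: continuous_cos.
apply: (@has_laplace_FTC _ (fun x => expR (- (t * x)) * g x)).
- by move=> x _; rewrite subr_ge0 cos_le1.
- by move=> x; apply: cvgB; [exact: cvg_cst|exact: ccos].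
- move=> x; have dg : is_derive x 1 g ((t ^+ 2 + xi ^+ 2)^-1 *
      (t * (- sin (x * xi) * xi) - xi * (cos (x * xi) * xi))).
    have dc := is_derive_scaled cos (fun y => - sin y) xi x (@is_derive_cos R).
    have ds := is_derive_scaled sin cos xi x (@is_derive_sin R).
    have := is_deriveB (is_deriveZ (t ^+ 2 + xi ^+ 2)^-1
      (is_deriveB (is_deriveZ t dc) (is_deriveZ xi ds))) (is_derive_cst (t^-1) x 1).
    by move/is_derive_eq; apply; rewrite subr0.
  apply: (is_derive_eq (is_derive_expRM _ _ _ _ dg)); rewrite /g.
  by field; rewrite !gt_eqF.
- apply: (cvg_expRM _ _ ((t ^+ 2 + xi ^+ 2)^-1 * (t + `|xi|) + t^-1)) => // x.
  rewrite /g (le_trans (ler_normB _ _))// (gtr0_norm (_ : 0 < t^-1)) ?invr_gt0//.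
  rewrite lerD2r normrM gtr0_norm ?invr_gt0// ler_pM2l ?invr_gt0//.
  rewrite (le_trans (ler_normB _ _))// !normrM (gtr0_norm t0).
  apply: lerD; last by rewrite ler_piMr ?sin_max.
  by rewrite ler_piMr ?(ltW t0)// ler_norml cos_geN1 cos_le1.
Qed.

(** The added 1 makes the integrand nonnegative and is removed again in [has_laplace_sin]. The
    antiderivative uses the imaginary part of e^{i x xi} / (t - i xi). *)
Lemma has_laplace_onem_sin xi t : 0 < t ->
  has_laplace (fun x => 1 - sin (x * xi)) t (t^-1 - xi / (t ^+ 2 + xi ^+ 2)).
Proof.
move=> t0; have n0 : 0 < t ^+ 2 + xi ^+ 2.
  by rewrite ltr_pwDl ?sqr_ge0// exprn_gt0.
pose g x := (t ^+ 2 + xi ^+ 2)^-1 * (t * sin (x * xi) + xi * cos (x * xi)) - t^-1.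
have -> : t^-1 - xi / (t ^+ 2 + xi ^+ 2) = - (expR (- (t * 0)) * g 0).
  by rewrite /g mulr0 oppr0 expR0 mul0r cos0 sin0; field; rewrite !gt_eqF.
have csin : continuous (fun x : R => sin (x * xi)).
  move=> x; apply: (@continuous_comp _ _ _ (fun x : R => x * xi) sin).
    by apply: cvgMl; exact: cvg_id.
  exact: continuous_sin.
apply: (@has_laplace_FTC _ (fun x => expR (- (t * x)) * g x)).
- by move=> x _; rewrite subr_ge0 sin_le1.
- by move=> x; apply: cvgB; [exact: cvg_cst|exact: csin].
- move=> x; have dg : is_derive x 1 g ((t ^+ 2 + xi ^+ 2)^-1 *
      (t * (cos (x * xi) * xi) + xi * (- sin (x * xi) * xi))).
    have dc := is_derive_scaled cos (fun y => - sin y) xi x (@is_derive_cos R).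
    have ds := is_derive_scaled sin cos xi x (@is_derive_sin R).
    have := is_deriveB (is_deriveZ (t ^+ 2 + xi ^+ 2)^-1
      (is_deriveD (is_deriveZ t ds) (is_deriveZ xi dc))) (is_derive_cst (t^-1) x 1).
    by move/is_derive_eq; apply; rewrite subr0.
  apply: (is_derive_eq (is_derive_expRM _ _ _ _ dg)); rewrite /g.
  by field; rewrite !gt_eqF.
- apply: (cvg_expRM _ _ ((t ^+ 2 + xi ^+ 2)^-1 * (t + `|xi|) + t^-1)) => // x.
  rewrite /g (le_trans (ler_normB _ _))// (gtr0_norm (_ : 0 < t^-1)) ?invr_gt0//.
  rewrite lerD2r normrM gtr0_norm ?invr_gt0// ler_pM2l ?invr_gt0//.
  rewrite (le_trans (ler_normD _ _))// !normrM (gtr0_norm t0).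
  apply: lerD; first by rewrite ler_piMr ?sin_max ?(ltW t0).
  by rewrite ler_piMr// ler_norml cos_geN1 cos_le1.
Qed.

End laplace_transforms.
(** * Stieltjes-Levy measures *)

Section stieltjes_weight.
Context {R : realType}.
Implicit Types (m t : R) (G : {measure set R -> \bar R}).

(** Positivity is kept as a separate condition because [m] may be 0, where the half-line has to stay
    open. *)
Definition half_line m : set R := [set t | 0 < t /\ m <= t].

(* Integrable against every element of [SLM m], whatever the coefficients [a2]
   and [a1] in its definition. *)
Definition weight m t : R := \1_(half_line m) t * (t * (1 + t) ^+ 2)^-1.

Definition weighted m G :=
  G (~` half_line m) = 0%E /\ G.-integrable setT (fun t => (weight m t)%:E).

Lemma half_lineE m : half_line m = `]0, +oo[ `&` `[m, +oo[.
Proof.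
by apply/seteqP; split=> t /=; rewrite !in_itv/= !andbT.
Qed.

Lemma measurable_half_line m : measurable (half_line m).
Proof. by rewrite half_lineE; exact: measurableI. Qed.

Lemma weight_ge0 m t : 0 <= weight m t.
Proof.
rewrite /weight indicE; case: (boolP (t \in _)) => [|_]; last by rewrite mul0r.
by rewrite inE => -[t0 _]; rewrite mul1r invr_ge0 mulr_ge0 ?sqr_ge0 ?(ltW t0).
Qed.

Lemma weight_gt0 m t : half_line m t -> 0 < weight m t.
Proof.
move=> mt; have [t0 _] := mt; rewrite /weight indicE mem_set// mul1r.
by rewrite invr_gt0 mulr_gt0// exprn_gt0// addr_gt0.
Qed.

Lemma measurable_weight m : measurable_fun setT (weight m).
Proof.
apply: measurable_funM; first by apply: measurable_indic; exact: measurable_half_line.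
apply: measurable_fun_invr; apply: measurable_funM => //.
by apply: measurable_funX; exact: measurable_funD.
Qed.

(** Since a2 t^2 + a1 t <= (a1 + a2) t (1 + t), the weight is at most (a1 + a2) times 1 / ((1 + t)
    (a2 t^2 + a1 t)), whose integral is finite by the condition on [H]. The support condition passes
    from [H] back to [G] because the density [q] is positive on the positive axis. *)
Lemma SLM_weighted m G : SLM m G -> weighted m G.
Proof.
move=> [G0 [a2 [a1 [a20 a10 a21 [H [[_ Hm Hfin] HG]]]]]].
pose P : set R := `]0, +oo[%classic.
have mP : measurable P by exact: measurable_itv.
have PE t : P t = (0 < t) :> Prop by rewrite /P/= in_itv/= andbT.
pose q t := (a2 * t ^+ 2 + a1 * t)^-1.
have q_gt0 t : 0 < t -> 0 < q t.
  move=> t0; rewrite invr_gt0; have t2 : 0 < t ^+ 2 by rewrite exprn_gt0.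
  have [a2p|a2p] := ltP 0 a2.
    by apply: ltr_pwDl; [rewrite mulr_gt0|rewrite mulr_ge0// ltW].
  have a1p : 0 < a1 by lra.
  by apply: ltr_wpDl; [rewrite mulr_ge0// ltW|rewrite mulr_gt0].
have mq : measurable_fun setT q.
  by apply: measurable_fun_invr; apply: measurable_funD; apply: measurable_funM => //.
pose g t := \1_P t * q t.
have g0 t : 0 <= g t.
  rewrite /g indicE; case: (boolP (t \in P)) => [|_]; last by rewrite mul0r.
  by rewrite inE PE => t0; rewrite mul1r ltW// q_gt0.
have mg : measurable_fun setT g.
  by apply: measurable_funM => //; exact: measurable_indic.
have Hg A : measurable A -> H A = (\int[G]_(t in A) (g t)%:E)%E.
  move=> mA; rewrite HG// integral_mkcondr; apply: eq_integral => t _.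
  by rewrite patchE /g indicE; case: ifP => _; rewrite ?mul1r ?mul0r.
have Gm : G (`]-oo, m[%classic `&` P) = 0%E.
  set A := _ `&` P; have mA : measurable A by exact: measurableI.
  have : (\int[G]_(t in A) `|(q t)%:E| = 0)%E.
    rewrite -Hm HG//; apply: eq_integral => t; rewrite inE => -[_]; rewrite PE => t0.
    by rewrite gee0_abs// lee_fin ltW// q_gt0.
  move/ae_eq_integral_abs => /(_ mA); case; first exact/measurable_EFinP/measurable_funTS.
  move=> N [mN N0 AN]; apply/eqP; rewrite eq_le measure_ge0 andbT -N0.
  apply: le_measure; rewrite ?inE// => t At; apply: AN => /= /(_ At)[q0].
  by case: At => _; rewrite PE => /q_gt0; rewrite q0 ltxx.
split.
  apply/eqP; rewrite eq_le measure_ge0 andbT.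
  rewrite (_ : ~` _ = `]-oo, 0]%classic `|` (`]-oo, m[%classic `&` P)).
    apply: (@le_trans _ _ (G `]-oo, 0%R]%classic + G (`]-oo, m[%classic `&` P))%E).
      by apply: measureU2; [exact: measurable_itv|exact: measurableI].
    by rewrite [in leLHS]G0 [in leLHS]Gm adde0.
  apply/seteqP; split => t /=; rewrite /half_line PE !in_itv/=.
    move=> h; have [t0|t0] := leP t 0; [by left|right; split=> //].
    by rewrite ltNge; apply/negP => mt; apply: h.
  move=> [t0|[tm t0]] [t0' mt]; first by move: t0; rewrite leNgt t0'.
  by move: tm; rewrite ltNge mt.
have mw : measurable_fun setT (fun t => (weight m t)%:E).
  by apply/measurable_EFinP; exact: measurable_weight.
apply/integrableP; split=> //.
pose h t := \1_P t * (1 + t)^-1.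
have mh : measurable_fun setT h.
  apply: measurable_funM; first exact: measurable_indic.
  by apply: measurable_fun_invr; exact: measurable_funD.
have h0 t : 0 <= h t.
  rewrite /h indicE; case: (boolP (t \in P)) => [|_]; last by rewrite mul0r.
  by rewrite inE PE => t0; rewrite mul1r invr_ge0 addr_ge0// ltW.
have Hh : (\int[G]_t ((h t)%:E * (g t)%:E) < +oo)%E.
  rewrite -(ge0_integral_density _ _ _ _ _ _ g0 mg Hg); last 2 first.
  - exact/measurable_EFinP.
  - by move=> t; rewrite lee_fin.
  have -> // : (\int[H]_t (h t)%:E = \int[H]_(t in P) ((1 + t)^-1)%:E)%E.
  rewrite [RHS]integral_mkcond; apply: eq_integral => t _; rewrite patchE /h indicE.
  by case: ifP => _; rewrite ?mul1r ?mul0r.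
apply: (@le_lt_trans _ _ (\int[G]_t ((a1 + a2)%:E * ((h t)%:E * (g t)%:E)))%E).
  apply: ge0_le_integral => //.
  - exact: measurableT_comp.
  - apply: emeasurable_funM => //; apply: emeasurable_funM; exact/measurable_EFinP.
  move=> t _; rewrite gee0_abs; last by rewrite lee_fin weight_ge0.
  rewrite -!EFinM lee_fin.
  have : 0 <= (a1 + a2) * (h t * g t).
    by apply: mulr_ge0; [exact: addr_ge0|exact: mulr_ge0].
  rewrite /weight /h /g !indicE.
  case: (boolP (t \in half_line m)) => [|_]; last by rewrite mul0r.
  rewrite inE => -[t0 _] _; rewrite mem_set ?PE// !mul1r.
  have t1 : 0 < 1 + t by rewrite addr_gt0.
  have d0 : 0 < a2 * t ^+ 2 + a1 * t by rewrite -invr_gt0 q_gt0.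
  have dt : a2 * t ^+ 2 + a1 * t <= (a1 + a2) * (t * (1 + t)).
    have : 0 <= a2 * t by rewrite mulr_ge0// ltW.
    have : 0 <= a1 * t ^+ 2 by rewrite mulr_ge0 ?sqr_ge0.
    nra.
  rewrite /q -invfM -[leLHS]mul1r ler_pdivrMr; last by rewrite mulr_gt0// exprn_gt0.
  rewrite mulrAC ler_pdivlMr ?mulr_gt0// mul1r.
  apply: le_trans (ler_wpM2l (ltW t1) dt) _.
  by rewrite (_ : (1 + t) * _ = (a1 + a2) * (t * (1 + t) ^+ 2))//; ring.
rewrite ge0_integralZl//.
- by rewrite lte_mul_pinfty// lee_fin addr_ge0.
- by apply: emeasurable_funM; exact/measurable_EFinP.
- by move=> t _; rewrite -EFinM lee_fin mulr_ge0.
- by rewrite lee_fin addr_ge0.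
Qed.

(** The weight is integrable and positive on the half-line: its superlevel sets have finite measure
    by Markov's inequality and exhaust the half-line, whose complement is null. *)
Lemma weighted_sigma_finite m G : weighted m G -> sigma_finite setT G.
Proof.
move=> [G0 iw]; pose E n := half_line m `&` [set t | 1 <= n.+1%:R * weight m t].
have mE n : measurable (E n).
  apply: measurableI; first exact: measurable_half_line.
  rewrite [X in measurable X](_ : _ =
      setT `&` (fun t => n.+1%:R * weight m t) @^-1` `[1, +oo[%classic).
    have mw : measurable_fun setT (fun t => n.+1%:R * weight m t).
      by apply: measurable_funM => //; exact: measurable_weight.
    exact: mw.
  by apply/seteqP; split => t /=; rewrite in_itv/= andbT; [move=> ?; split|case].
exists (fun n => ~` half_line m `|` E n).
  apply/seteqP; split => // t _; have [mt|mt] := pselect (half_line m t); last first.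
    by exists 0%N => //; left.
  exists (Num.trunc (weight m t)^-1) => //; right; split => //=.
  have := truncnS_gt (weight m t)^-1.
  by rewrite -[X in X < _ -> _]div1r ltr_pdivrMr ?weight_gt0// => /ltW.
move=> n; split.
  by apply: measurableU => //; apply: measurableC; exact: measurable_half_line.
apply: (@le_lt_trans _ _ (G (~` half_line m) + G (E n))%E).
  by apply: measureU2 => //; apply: measurableC; exact: measurable_half_line.
rewrite G0 add0e -(setIT (E n)) -integral_indic//.
have iw' := integrableZl measurableT n.+1%:R iw.
case/integrableP : (iw') => mw'; apply: le_lt_trans.
apply: ge0_le_integral => //; [|exact: measurableT_comp|].
  by apply/measurable_EFinP; exact: measurable_indic.
move=> t _; rewrite lee_fin ger0_norm; last by rewrite mulr_ge0// weight_ge0.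
rewrite indicE; case: (boolP (t \in E n)) => [|_]; last by rewrite mulr_ge0// weight_ge0.
by rewrite inE => -[].
Qed.

Lemma weighted_laplace m G x : weighted m G ->
  laplace G x = Rintegral G setT (fun t => \1_(half_line m) t * expR (- (t * x))).
Proof.
move=> [G0 _]; rewrite /laplace /Rintegral; congr fine.
have me : measurable_fun setT (fun t : R => (expR (- (t * x)))%:E).
  apply/measurable_EFinP; apply: (measurableT_comp (@measurable_expR R)).
  by apply: measurableT_comp => //; exact: measurable_funM.
rewrite (ge0_negligible_integral (measurableC (measurable_half_line m))
  _ (measurable_funTS me) _ G0)//.
rewrite setDE setCK integral_mkcond; apply: eq_integral => t _.
rewrite patchE indicE (_ : (t \in _ `&` half_line m) = (t \in half_line m)).
  by case: ifP => _; rewrite ?mul1r ?mul0r.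
apply/idP/idP; rewrite !inE; first by case.
by move=> h; split=> //=; rewrite in_itv/= andbT; case: h.
Qed.

Lemma weighted_integrable_expR m G x : weighted m G -> 0 < x ->
  G.-integrable setT (fun t => (\1_(half_line m) t * expR (- (t * x)))%:E).
Proof.
(* With s <= 1, s (1 + t) <= 1 + t s <= e^{t s}. Cubing and 3 s <= x give s^3 t (1 + t)^2 <= e^{t
   x}, so e^{-t x} is at most s^{-3} times the weight. *)
move=> [_ iw] x0; pose s := Num.min (x / 3) 1.
have s0 : 0 < s by rewrite lt_min divr_gt0//=.
have sx : 3 * s <= x by rewrite mulrC -ler_pdivlMr// ge_min lexx.
have s1 : s <= 1 by rewrite ge_min lexx orbT.
apply: (le_integrable _ _ _ (integrableZl measurableT (s ^+ 3)^-1 iw)) => //.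
  apply/measurable_EFinP; apply: measurable_funM.
    apply: measurable_indic; exact: measurable_half_line.
  apply: (measurableT_comp (@measurable_expR R)).
  by apply: measurableT_comp => //; exact: measurable_funM.
move=> t _; rewrite lee_fin [leRHS]ger0_norm; last first.
  by rewrite mulr_ge0 ?weight_ge0// invr_ge0 exprn_ge0// ltW.
rewrite /weight indicE; case: (boolP (t \in _)) => [|_]; last by rewrite !mul0r normr0 mulr0.
rewrite inE => -[t0 _]; rewrite !mul1r ger0_norm ?expR_ge0// expRN -invfM.
have t1 : 0 < 1 + t by rewrite addr_gt0.
rewrite lef_pV2 ?posrE ?expR_gt0 ?mulr_gt0 ?exprn_gt0//.
have h1 : s * (1 + t) <= expR (t * s) by have := expR_ge1Dx (t * s); nra.
apply: (@le_trans _ _ ((s * (1 + t)) ^+ 3)).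
  by rewrite exprMn ler_pM2l ?exprn_gt0// [leRHS]exprS ler_pM2r ?exprn_gt0// lerDr.
apply: (@le_trans _ _ (expR (t * s) ^+ 3)).
  by rewrite lerXn2r ?nnegrE ?expR_ge0// mulr_ge0// ltW.
by rewrite -expRM_natl ler_expR mulrCA ler_pM2l.
Qed.

End stieltjes_weight.

(** * Fubini for a kernel against a Laplace transform *)

Section laplace_fubini.
Context {R : realType}.
Local Notation leb := (@lebesgue_measure R).
Local Notation pos := (`]0, +oo[%classic : set R).

Lemma has_laplace_onem_expR_sqr (t C : R) : 0 < t ->
  has_laplace (fun x => C * (1 - expR (- x)) ^+ 2) t
    (C * (t^-1 - 2 * (1 + t)^-1 + (2 + t)^-1)).
Proof.
move=> t0; apply: has_laplaceZ.
have h0 := has_laplace_expR 0 t; rewrite add0r in h0.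
have h1 := has_laplaceZ 2 _ _ _ (has_laplace_expR 1 t (addr_gt0 ltr01 t0)).
have h2 := has_laplaceZ (-1) _ _ _ (has_laplace_expR 2 t (addr_gt0 (ltr0Sn _ _) t0)).
have := has_laplaceB _ _ _ _ _ (has_laplaceB _ _ _ _ _ (h0 t0) h1) h2.
rewrite mulN1r opprK; congr (has_laplace _ _ _); apply/funext => x.
rewrite mul0r oppr0 expR0 mul1r mulN1r opprK (_ : - (2 * x) = - x - x); last ring.
by rewrite expRD; ring.
Qed.

Variables (G : {sigma_finite_measure set R -> \bar R}) (m : R).
Hypothesis Gw : weighted m G.
Variables (q Q : R -> R) (C : R).
Hypotheses (C0 : 0 <= C) (mq : measurable_fun setT q).
Hypothesis qC : forall x, 0 < x -> `|q x| <= C * (1 - expR (- x)) ^+ 2.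
Hypothesis qQ : forall t, 0 < t -> has_laplace q t (Q t).

(** Both domains are encoded by indicators, so that Fubini applies on the full product space. *)
Let p (z : measurableTypeR R * R) : \bar R :=
  (\1_pos z.1 * q z.1 * (\1_(half_line m) z.2 * expR (- (z.2 * z.1))))%:E.

Let mp : measurable_fun setT p.
Proof.
have m1 (h : R -> R) : measurable_fun setT h ->
    measurable_fun setT (fun z : measurableTypeR R * R => h z.1).
  by move=> mh; apply: (measurableT_comp (f := h : measurableTypeR R -> R)).
have m2 (h : R -> R) : measurable_fun setT h ->
    measurable_fun setT (fun z : measurableTypeR R * R => h z.2).
  by move=> mh; exact: measurableT_comp.
apply/measurable_EFinP; apply: measurable_funM; apply: measurable_funM.
- by apply: m1; apply: measurable_indic; exact: measurable_itv.
- exact: m1.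
- by apply: m2; apply: measurable_indic; exact: measurable_half_line.
- apply: (measurableT_comp (@measurable_expR R)); apply: measurableT_comp => //.
  by apply: measurable_funM; [exact: (m2 id)|exact: (m1 id)].
Qed.

Let posE x : pos x = (0 < x) :> Prop.
Proof. by rewrite /= in_itv/= andbT. Qed.

Let inner_bound t :
  (\int[leb]_x `|p (x, t)| <= (2 * C)%:E * (weight m t)%:E)%E.
Proof.
have [mt|mt] := pselect (half_line m t); last first.
  rewrite integral0_eq; first by rewrite -EFinM lee_fin mulr_ge0 ?weight_ge0 ?mulr_ge0.
  by move=> x _; rewrite /p/= [\1_(half_line m) t]indicE memNset// mul0r mulr0 normr0.
have [t0 _] := mt.
have [/integrableP[mi _] hr] := has_laplace_onem_expR_sqr t C t0.
apply: (@le_trans _ _ (\int[leb]_(x in pos)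
    (C * (1 - expR (- x)) ^+ 2 * expR (- (t * x)))%:E)%E).
  rewrite [leRHS]integral_mkcond; apply: ge0_le_integral => //.
  - apply: measurableT_comp => //.
    by apply: (measurableT_comp mp); exact: pair2_measurable.
  - by apply/(measurable_restrictT _ (measurable_itv _)); exact: mi.
  move=> x _; rewrite patchE /p/= !indicE [t \in _]mem_set//; case: ifP => [|_].
    rewrite inE posE => x0; rewrite !mul1r lee_fin normrM.
    by rewrite (ger0_norm (expR_ge0 _)) ler_wpM2r ?expR_ge0 ?qC.
  by rewrite !mul0r normr0.
move: hr; rewrite /Rintegral => hr.
have fin := integrable_fin_num _ (has_laplace_onem_expR_sqr t C t0).1.
rewrite -(fineK (fin _)); last exact: measurable_itv.
rewrite hr -EFinM lee_fin /weight indicE mem_set// mul1r [2 * C]mulrC -mulrA ler_wpM2l//.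
(* The second difference of 1/t decays like t^{-3}; replacing 2 + t by 1 + t then yields the
   weight. *)
rewrite (_ : t^-1 - _ + _ = 2 * (t * (1 + t) * (2 + t))^-1); last first.
  by field; rewrite !gt_eqF// addr_gt0.
rewrite ler_wpM2l// lef_pV2 ?posrE ?mulr_gt0 ?exprn_gt0 ?addr_gt0//.
rewrite -mulrA ler_pM2l// expr2 ler_pM2l ?addr_gt0// lerD2r.
by rewrite ler1n.
Qed.

Let ip : (leb \x G)%E.-integrable setT p.
Proof.
apply/(integrable21ltyP _ _ mp).
apply: (@le_lt_trans _ _ (\int[G]_t ((2 * C)%:E * (weight m t)%:E))%E).
  apply: ge0_le_integral => //.
  - by move=> t _; exact: integral_ge0.
  - apply: (measurable_fun_fubini_tonelli_G (fun z => `|p z|%E)) => //.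
    exact: measurableT_comp.
  - by apply: emeasurable_funM => //; apply/measurable_EFinP; exact: measurable_weight.
rewrite ge0_integralZl//.
- rewrite lte_mul_pinfty// ?lee_fin ?mulr_ge0//.
  have [_ /integrableP[_]] := Gw; apply: le_lt_trans.
  apply: ge0_le_integral => //.
  + by move=> t _; rewrite lee_fin weight_ge0.
  + by apply/measurable_EFinP; exact: measurable_weight.
  + by apply: measurableT_comp => //; apply/measurable_EFinP; exact: measurable_weight.
  + by move=> t _; rewrite lee_fin ler_norm.
- by apply/measurable_EFinP; exact: measurable_weight.
- by move=> t _; rewrite lee_fin weight_ge0.
- by rewrite lee_fin mulr_ge0.
Qed.

Let innerG x : (\int[G]_t p (x, t) = (\1_pos x * q x * laplace G x)%:E)%E.
Proof.
rewrite /p/= indicE; case: (boolP (x \in pos)) => [|_]; last first.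
  by rewrite !mul0r integral0_eq// => t _; rewrite mul0r.
rewrite inE posE => x0; rewrite mul1r.
have iE := weighted_integrable_expR _ _ _ Gw x0.
under eq_integral do rewrite EFinM.
rewrite integralZl// (weighted_laplace _ _ _ Gw) EFinM; congr (_ * _)%E.
by rewrite fineK// integrable_fin_num.
Qed.

Let innerL t : (\int[leb]_x p (x, t) = (\1_(half_line m) t * Q t)%:E)%E.
Proof.
rewrite /p/= [\1_(half_line m) t]indicE.
case: (boolP (t \in _)) => [|_]; last first.
  by rewrite !mul0r integral0_eq// => x _; rewrite mul0r mulr0.
rewrite inE => -[t0 _]; rewrite mul1r.
have [iq <-] := qQ _ t0; rewrite fineK; last first.
  by apply: integrable_fin_num => //; exact: measurable_itv.
rewrite [RHS]integral_mkcond; apply: eq_integral => x _.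
by rewrite patchE indicE; case: ifP => _; rewrite ?mul0r ?mul1r.
Qed.

Lemma laplace_Fubini :
  leb.-integrable setT (fun x => (\1_pos x * q x * laplace G x)%:E) /\
  Rintegral leb setT (fun x => \1_pos x * q x * laplace G x) =
  Rintegral G setT (fun t => \1_(half_line m) t * Q t).
Proof.
split.
- apply: (eq_integrable _ _ _ _ (integrable_fubini_F ip)) => // x _.
  exact: innerG.
- rewrite /Rintegral; congr fine.
  under eq_integral do rewrite -innerG.
  rewrite (Fubini ip); apply: eq_integral => t _; exact: innerL.
Qed.

End laplace_fubini.
(** * The Stieltjes transform *)

Section stieltjes_transform.
Context {R : realType}.
Variables (G : {measure set R -> \bar R}) (m : R).
Hypothesis Gw : weighted m G.
Local Notation normc := (@Normc.normc R).
Implicit Types (u h z : R[i]) (c t eta : R).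

(** The powers n = 1 and n = 2 give the transform and its derivative in [u]. The factor 1 / (t (1 +
    t)) is the weight up to one factor 1 + t, which the resolvent supplies. *)
Definition stieltjes_kernel (n : nat) u t : R[i] :=
  (\1_(half_line m) t / (t * (1 + t)))%:C%C * (t%:C%C - u)^-1 ^+ n.

Definition stieltjes u : R[i] := cintegral G (stieltjes_kernel 1 u).

(** The distance to the cut is measured relative to 1 + t, so that one constant controls the
    resolvent for bounded and for large [t]; half of it survives perturbations of [u] of size c /
    2. *)
Definition separated c u :=
  0 < c /\ forall t, half_line m t -> c * (1 + t) <= normc (t%:C%C - u).

Let cmeasurable_kernel n u : cmeasurable (stieltjes_kernel n u).
Proof.
apply: cmeasurableM.
  apply: cmeasurable_real; apply: measurable_funM.
    by apply: measurable_indic; exact: measurable_half_line.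
  apply: measurable_fun_invr; apply: measurable_funM => //.
  exact: measurable_funD.
elim: n => [|n IH].
  under eq_fun do rewrite expr0; exact: cmeasurable_cst.
under eq_fun do rewrite exprS; apply: cmeasurableM => //.
apply: cmeasurableV; apply: cmeasurableB; last exact: cmeasurable_cst.
exact: (@cmeasurable_real _ _ _ id).
Qed.

Let normc_kernel n u c t : separated c u ->
  normc (stieltjes_kernel n.+1 u t) <= (c ^+ n.+1)^-1 * weight m t.
Proof.
move=> [c0 cu]; rewrite /stieltjes_kernel /weight indicE.
case: (boolP (t \in _)) => [|_]; last first.
  by rewrite !mul0r mulr0 Normc.normc0.
rewrite inE => mt; have [t0 _] := mt; have t1 : 0 < 1 + t by rewrite addr_gt0.
rewrite !mul1r Normc.normcM normc_real normcXn Normc.normcV.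
rewrite ger0_norm ?invr_ge0 ?mulr_ge0 ?(ltW t0) ?(ltW t1)//.
have h : (normc (t%:C%C - u))^-1 ^+ n.+1 <= (c ^+ n.+1)^-1 * (1 + t)^-1.
  apply: (@le_trans _ _ ((c * (1 + t))^-1 ^+ n.+1)).
    have p0 : 0 < c * (1 + t) by rewrite mulr_gt0.
    have p1 := lt_le_trans p0 (cu _ mt).
    rewrite lerXn2r// ?nnegrE; [by rewrite invr_ge0 ltW|by rewrite invr_ge0 ltW|].
    by rewrite lef_pV2 ?posrE ?cu.
  rewrite exprVn exprMn invfM ler_pM2l ?invr_gt0 ?exprn_gt0//.
  rewrite lef_pV2 ?posrE ?exprn_gt0//.
  by rewrite ler_eXnr// lerDl ltW.
apply: (le_trans (ler_wpM2l _ h)); first by rewrite invr_ge0 mulr_ge0// ltW.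
rewrite le_eqVlt; apply/orP; left; apply/eqP.
by field; rewrite !gt_eqF ?exprn_gt0.
Qed.

Let weight_bound n u c : separated c u ->
  cintegrable G (stieltjes_kernel n.+1 u) /\
  normc (cintegral G (stieltjes_kernel n.+1 u)) <=
    2 * ((c ^+ n.+1)^-1 * Rintegral G setT (weight m)).
Proof.
move=> cu; rewrite -RintegralZl//; last exact: Gw.2.
apply: normc_cintegral_le; first exact: cmeasurable_kernel.
  exact: (integrableZl measurableT _ Gw.2).
by move=> t; exact: normc_kernel.
Qed.

Lemma normc_stieltjes_le u c : separated c u ->
  normc (stieltjes u) <= 2 * (c^-1 * Rintegral G setT (weight m)).
Proof. by move=> cu; have [_] := weight_bound 0 u c cu; rewrite expr1. Qed.

Let separated_shift u c h : separated c u -> normc h <= c / 2 ->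
  separated (c / 2) (u + h).
Proof.
move=> [c0 cu] hc; split=> [|t mt]; first by rewrite divr_gt0.
have [t0 _] := mt; have := cu _ mt; have := ler_normcB (t%:C%C - u) h.
rewrite opprD addrA => h1 h2; apply: le_trans h1.
by nra.
Qed.

Let separated_neq0 u c t : separated c u -> half_line m t -> t%:C%C - u != 0.
Proof.
move=> [c0 cu] mt; have [t0 _] := mt; apply/eqP => e.
have := cu _ mt; rewrite e Normc.normc0 leNgt mulr_gt0//.
by rewrite addr_gt0.
Qed.

(* Second-order remainder of the resolvent [1 / (t - u)]. *)
Let kernel_remainder u c h t : separated c u -> normc h <= c / 2 ->
  normc (stieltjes_kernel 1 (u + h) t - stieltjes_kernel 1 u t -
         h * stieltjes_kernel 2 u t) <=
  normc h ^+ 2 * (2 / c ^+ 3) * weight m t.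
Proof.
move=> cu hc; have cuh := separated_shift _ _ _ cu hc.
have [c0 _] := cu.
have -> : stieltjes_kernel 1 (u + h) t - stieltjes_kernel 1 u t -
    h * stieltjes_kernel 2 u t =
    h ^+ 2 * (t%:C%C - (u + h))^-1 * stieltjes_kernel 2 u t.
  rewrite /stieltjes_kernel indicE; case: (boolP (t \in _)) => [|_]; last first.
    by rewrite !mul0r; ring.
  rewrite inE => mt; have nu := separated_neq0 _ _ _ cu mt.
  have nuh := separated_neq0 _ _ _ cuh mt.
  rewrite !opprD !addrA in nuh *; move: (t%:C%C - u) nu nuh => A nA nAh.
  by move: (_ / _)%:C%C => v; field; rewrite nA nAh.
have h2 : normc (h ^+ 2 * (t%:C%C - (u + h))^-1 * stieltjes_kernel 2 u t) =
    normc h ^+ 2 * (normc (t%:C%C - (u + h))^-1 * normc (stieltjes_kernel 2 u t)).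
  by rewrite Normc.normcM (Normc.normcM (h ^+ 2)) normcXn mulrA.
have e : normc h ^+ 2 * (2 / c ^+ 3) * weight m t =
    normc h ^+ 2 * (2 / c * ((c ^+ 2)^-1 * weight m t)).
  by field; rewrite gt_eqF.
rewrite {}h2 {}e; apply: ler_wpM2l; first by rewrite exprn_ge0// normc_ge0.
have [mt|mt] := pselect (half_line m t); last first.
  rewrite /stieltjes_kernel /weight indicE memNset// !mul0r.
  by rewrite Normc.normc0 !mulr0.
have [t0 _] := mt.
apply: ler_pM; [exact: normc_ge0|exact: normc_ge0| |exact: (normc_kernel 1)].
have p1 : 0 < c / 2 * (1 + t) by rewrite mulr_gt0 ?divr_gt0 ?addr_gt0.
have p2 := lt_le_trans p1 (cuh.2 _ mt).
rewrite Normc.normcV -[2 / c]invf_div lef_pV2 ?posrE ?divr_gt0//.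
by apply: le_trans (cuh.2 _ mt); rewrite ler_peMr ?divr_ge0 ?(ltW c0)// lerDl ltW.
Qed.

(** The pointwise remainder is bounded by |h|^2 times a multiple of the weight, uniformly in small
    [h], so integrating it gives the expansion directly, with [D] the integral of the squared
    resolvent. *)
Lemma stieltjes_quadratic u c : separated c u ->
  exists D K, forall h, normc h <= c / 2 ->
    normc (stieltjes (u + h) - stieltjes u - h * D) <= K * normc h ^+ 2.
Proof.
move=> cu; exists (cintegral G (stieltjes_kernel 2 u)).
exists (2 * (2 / c ^+ 3 * Rintegral G setT (weight m))) => h hc.
have cuh := separated_shift _ _ _ cu hc.
have [i1 _] := weight_bound 0 _ _ cuh.
have [i2 _] := weight_bound 0 _ _ cu.
have [i3 _] := weight_bound 1 _ _ cu.
pose r t := stieltjes_kernel 1 (u + h) t - stieltjes_kernel 1 u t.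
have mr : cmeasurable r by apply: cmeasurableB; exact: cmeasurable_kernel.
have mh3 : cmeasurable (fun t => h * stieltjes_kernel 2 u t).
  by apply: cmeasurableM; [exact: cmeasurable_cst|exact: cmeasurable_kernel].
have ir : cintegrable G r.
  have [i1r i1i] := i1; have [i2r i2i] := i2; split.
    apply: (eq_integrable _ _ _ _ (integrableB _ i1r i2r)) => // t _.
    by rewrite /= /r; case: (stieltjes_kernel _ _ _) (stieltjes_kernel _ _ _) => [? ?] [? ?].
  apply: (eq_integrable _ _ _ _ (integrableB _ i1i i2i)) => // t _.
  by rewrite /= /r; case: (stieltjes_kernel _ _ _) (stieltjes_kernel _ _ _) => [? ?] [? ?].
have ih3 : cintegrable G (fun t => h * stieltjes_kernel 2 u t).
  have iw := integrableZl measurableT (normc h * (c ^+ 2)^-1) Gw.2.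
  apply: (normc_cintegral_le _ _ _ _ _ _ mh3 iw _).1 => t.
  rewrite Normc.normcM -mulrA ler_wpM2l ?normc_ge0//; exact: normc_kernel.
rewrite /stieltjes -cintegralZl// -cintegralB// -/r -cintegralB//.
have := normc_cintegral_le _ _ _ G _ _ (cmeasurableB _ _ _ _ _ mr mh3)
  (integrableZl measurableT (normc h ^+ 2 * (2 / c ^+ 3)) Gw.2)
  (fun t => kernel_remainder u c h t cu hc).
move=> [_ /le_trans]; apply; rewrite RintegralZl//; last exact: Gw.2.
by rewrite le_eqVlt; apply/orP; left; apply/eqP; ring.
Qed.

(** In the application [a] is ['i] or [- 'i]; modulus 1 keeps the size of the increment
    unchanged. *)
Lemma derivable_stieltjes a z c : normc a = 1 -> separated c (a * z) ->
  derivable ((fun z => stieltjes (a * z)) : R[i]^o -> R[i]^o) z 1.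
Proof.
move=> a1 cu; have [c0 _] := cu.
have [D [K DK]] := stieltjes_quadratic _ _ cu.
apply: (derivable_quadratic _ _ (a * D) (c / 2) K); first by rewrite divr_gt0.
move=> h hc; have := DK (a * h); rewrite Normc.normcM a1 mul1r => /(_ hc).
by rewrite mulrDr mulrA (mulrC h).
Qed.

(** Let N = |t - u|, so that N >= e and N >= t - |u|. Adding (1 + |u|) times the first to e times
    the second gives N (1 + |u| + e) >= e (1 + t), which explains the constant. *)
Let separated_gap u e : 0 < e ->
  (forall t, half_line m t -> e <= normc (t%:C%C - u)) ->
  separated (e / (1 + normc u + e)) u.
Proof.
move=> e0 eu; have u0 := normc_ge0 u.
have d0 : 0 < 1 + normc u + e by rewrite addr_gt0// ltr_pwDl.
split=> [|t mt]; first by rewrite divr_gt0.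
have := eu _ mt; have := ler_normcB t%:C%C u; rewrite normc_real.
have [t0 _] := mt; rewrite gtr0_norm// => h1 h2.
by rewrite mulrAC ler_pdivrMr//; nra.
Qed.

Lemma separated_Im u e : 0 < e -> e <= `|complex.Im u| ->
  separated (e / (1 + normc u + e)) u.
Proof.
move=> e0 eu; apply: separated_gap => // t _.
apply: (le_trans eu); rewrite -normrN.
by have := Im_le_normc (t%:C%C - u); case: u {eu} => a b /=; rewrite sub0r.
Qed.

Lemma separated_Re u : complex.Re u < m ->
  separated ((m - complex.Re u) / (1 + normc u + (m - complex.Re u))) u.
Proof.
move=> um; apply: separated_gap => [|t [_ mt]]; first by rewrite subr_gt0.
have := Re_le_normc (t%:C%C - u); case: u um => a b /= um.
by apply: le_trans; rewrite ger0_norm; lra.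
Qed.

(* On the imaginary axis, [- u (1 + u) S(u)] is the [G]-integral of the Laplace
   transform of [1 - e^{i x eta} + i eta (1 - e^{-x})]. *)
Lemma stieltjes_imaginary eta :
  - ('i%C * eta%:C%C) * (1 + 'i%C * eta%:C%C) * stieltjes ('i%C * eta%:C%C) =
  (Rintegral G setT (fun t => \1_(half_line m) t *
     (t^-1 - t / (t ^+ 2 + eta ^+ 2))) +i*
   Rintegral G setT (fun t => \1_(half_line m) t *
     (- (eta / (t ^+ 2 + eta ^+ 2)) + eta * (t^-1 - (1 + t)^-1))))%C.
Proof.
(* At eta = 0 the point u = 0 may touch the cut, so no separation is available; both sides vanish
   there because of the factor [u]. *)
have [->|eta0] := eqVneq eta 0.
  have Z (f : R -> R) : (forall t, 0 < t -> f t = 0) ->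
      Rintegral G setT (fun t => \1_(half_line m) t * f t) = 0.
    move=> f0; rewrite /Rintegral integral0_eq// => t _; rewrite indicE.
    case: (boolP (t \in _)) => [|_]; last by rewrite mul0r.
    by rewrite inE => -[t0 _]; rewrite f0// mulr0.
  rewrite (_ : 0%:C%C = 0 :> R[i])// mulr0 oppr0 !mul0r !Z// => t t0.
    by rewrite expr0n addr0; field; rewrite gt_eqF.
  by rewrite !mul0r oppr0 addr0.
have e0 : 0 < `|eta| by rewrite normr_gt0.
have eI : `|eta| <= `|complex.Im ('i%C * eta%:C%C)|.
  by rewrite /= mulr0 mul1r add0r.
have [i1 _] := weight_bound 0 _ _ (separated_Im _ _ e0 eI).
have kernelE t : - ('i%C * eta%:C%C) * (1 + 'i%C * eta%:C%C) *
    stieltjes_kernel 1 ('i%C * eta%:C%C) t =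
    ((\1_(half_line m) t * (t^-1 - t / (t ^+ 2 + eta ^+ 2))) +i*
     (\1_(half_line m) t *
       (- (eta / (t ^+ 2 + eta ^+ 2)) + eta * (t^-1 - (1 + t)^-1))))%C.
  rewrite /stieltjes_kernel expr1 indicE.
  case: (boolP (t \in _)) => [|_]; last by rewrite !mul0r mulr0.
  rewrite inE => -[t0 _]; rewrite !mul1r.
  have n0 : t ^+ 2 + eta ^+ 2 != 0 by rewrite gt_eqF// ltr_pwDl ?exprn_gt0 ?sqr_ge0.
  have n1 : 1 + t != 0 by rewrite gt_eqF// addr_gt0.
  have n2 : t != 0 by rewrite gt_eqF.
  apply/eqP; rewrite eq_complex /=; apply/andP; split; apply/eqP;
    rewrite !(mul0r, mul1r, mulr0, subr0, add0r, sub0r, oppr0, addr0, sqrrN);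
    by field; rewrite n0 n1 n2.
rewrite /stieltjes -cintegralZl// /cintegral.
by congr (_ +i* _)%C; apply: eq_Rintegral => t _; rewrite kernelE.
Qed.

End stieltjes_transform.
(** * The Levy-Khintchine integral *)

Section reflection.
Context {R : realType}.
Local Notation leb := (@lebesgue_measure R).

Lemma integrable_lebesgueN (r : R -> R) :
  leb.-integrable setT (fun x => (r x)%:E) ->
  leb.-integrable setT (fun x => (r (- x))%:E) /\
  Rintegral leb setT (fun x => r (- x)) = Rintegral leb setT r.
Proof.
pose opp := (-%R : measurableTypeR R -> measurableTypeR R).
have mopp : measurable_fun setT opp by exact: (@oppr_measurable R setT).
move=> ir; have /measurable_EFinP mr := measurable_int _ ir.
have mrE : measurable_fun [set: measurableTypeR R] (EFin \o r) by exact/measurable_EFinP.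
have eqI (f : measurableTypeR R -> \bar R) :
    (\int[leb]_x f x = \int[pushforward leb opp]_x f x)%E.
  by apply: eq_measure_integral => A mA _; exact/esym/lebesgue_measureN.
have irN : leb.-integrable setT (fun x => (r (- x))%:E).
  apply/integrableP; split.
    by apply/measurable_EFinP; exact: (measurableT_comp mr mopp).
  case/integrableP : ir => _; rewrite eqI ge0_integral_pushforward//.
  exact: measurableT_comp.
split => //; rewrite /Rintegral; congr fine.
by rewrite [RHS]eqI integral_pushforward.
Qed.

End reflection.

Section lebesgue_density.
Context {R : realType}.
Local Notation leb := (@lebesgue_measure R).

Lemma integrable_levy_density (F : {measure set R -> \bar R}) (f q : R -> R) :
  (forall x, 0 <= f x) -> measurable_fun setT f -> has_levy_density F f ->
  measurable_fun setT q ->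
  leb.-integrable setT (fun x => (q x * f x)%:E) ->
  F.-integrable setT (fun x => (q x)%:E) /\
  Rintegral F setT q = Rintegral leb setT (fun x => q x * f x).
Proof.
move=> f0 mf Ff mq iqf.
(* The identity transports Lebesgue measure from its own copy of the line to the one that carries
   [F]. *)
pose id' := (idfun : measurableTypeR R -> R).
have mid : measurable_fun setT id' by move=> _ Y mY; rewrite setTI.
pose N := pushforward leb id'.
have FN A : measurable A -> F A = (\int[N]_(x in A) (f x)%:E)%E.
  move=> mA; rewrite Ff// ge0_integral_pushforward//.
    exact/measurable_EFinP/measurable_funTS.
  by move=> x _; rewrite lee_fin.
have mqf : measurable_fun setT (fun x => (q x * f x)%:E).
  by apply/measurable_EFinP; exact: measurable_funM.
have iN : N.-integrable setT (fun x => (q x * f x)%:E).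
  exact: integrable_pushforward.
have [iF eF] := integrable_density _ _ _ _ _ _ f0 mf FN _ mq iN.
split => //; rewrite /Rintegral eF; congr fine.
exact: integral_pushforward.
Qed.

End lebesgue_density.

(** Sigma-finiteness follows from the weight condition; [G'] is [G] repackaged with that structure,
    as Fubini expects it. *)
Lemma laplace_Fubini_weighted (R : realType) (G : {measure set R -> \bar R})
    (m : R) (q Q : R -> R) (C : R) :
  weighted m G -> 0 <= C -> measurable_fun setT q ->
  (forall x, 0 < x -> `|q x| <= C * (1 - expR (- x)) ^+ 2) ->
  (forall t, 0 < t -> has_laplace q t (Q t)) ->
  lebesgue_measure.-integrable setT (fun x => (\1_`]0, +oo[ x * q x * laplace G x)%:E) /\
  Rintegral lebesgue_measure setT (fun x => \1_`]0, +oo[ x * q x * laplace G x) =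
  Rintegral G setT (fun t => \1_(half_line m) t * Q t).
Proof.
move=> Gw; have sG := weighted_sigma_finite _ _ Gw.
pose H1 := isSFinite.Build _ _ _ _ (sfinite_measure_sigma_finite sG).
pose H2 := isSigmaFinite.Build _ _ _ _ sG.
pose G' := HB.pack_for {sigma_finite_measure set R -> \bar R} (Measure.sort G) H1 H2.
have GE : G = G' by exact: eq_measure.
by rewrite GE in Gw *; exact: laplace_Fubini.
Qed.

(** Fubini makes the product with (1 - e^{-x})^2 integrable, hence measurable; this factor does not
    vanish for x > 0 and can be divided out. *)
Lemma measurable_laplace (R : realType) (G : {measure set R -> \bar R}) (m : R) :
  weighted m G -> measurable_fun setT (fun x : R => \1_`]0, +oo[ x * laplace G x).
Proof.
move=> Gw; pose q (x : R) : R := (1 - expR (- x)) ^+ 2.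
have mq : measurable_fun setT q.
  apply: measurable_funX; apply: measurable_funB => //.
  exact: (measurableT_comp (@measurable_expR R)).
have [||i _] := laplace_Fubini_weighted R G m q
    (fun t => 1 * (t^-1 - 2 * (1 + t)^-1 + (2 + t)^-1)) 1 Gw ler01 mq.
- by move=> x _; rewrite ger0_norm ?sqr_ge0// mul1r.
- move=> t t0; have := has_laplace_onem_expR_sqr t 1 t0.
  by congr (has_laplace _ _ _); apply/funext => x; rewrite mul1r.
have /measurable_EFinP mi := measurable_int _ i.
apply: (eq_measurable_fun (fun x : R => \1_`]0, +oo[ x * q x * laplace G x * (q x)^-1)).
  move=> x _; rewrite indicE; case: (boolP (x \in _)) => [|_]; last by rewrite !mul0r.
  rewrite inE/= in_itv/= andbT => x0.
  have q0 : q x != 0 by rewrite gt_eqF// exprn_gt0// subr_gt0 -expR0 ltr_expR; lra.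
  by field.
by apply: measurable_funM => //; exact: measurable_fun_invr.
Qed.

Lemma has_laplace_ext (R : realType) (q1 q2 : R -> R) (t r : R) :
  (forall x, 0 < x -> q1 x = q2 x) -> has_laplace q1 t r -> has_laplace q2 t r.
Proof.
move=> e [i <-]; split.
  apply: (eq_integrable _ _ _ _ i); first exact: measurable_itv.
  by move=> x; rewrite inE/= in_itv/= andbT => x0; rewrite e.
by apply: eq_Rintegral => x; rewrite inE/= in_itv/= andbT => x0; rewrite e.
Qed.

(** For the gap between the two truncations only integrability matters, so the integral itself
    serves as the value of the transform. *)
Lemma has_laplace_dominated (R : realType) (q : R -> R) (C t : R) : 0 < t ->
  measurable_fun setT q ->
  (forall x, 0 < x -> `|q x| <= C * (1 - expR (- x)) ^+ 2) ->
  has_laplace q t (Rintegral lebesgue_measure `]0, +oo[ (fun x => q x * expR (- (t * x)))).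
Proof.
move=> t0 mq qC; split => //.
apply: (le_integrable _ _ _ (has_laplace_onem_expR_sqr t C t0).1).
- exact: measurable_itv.
- apply/measurable_EFinP; apply: measurable_funTS; apply: measurable_funM => //.
  have mt : measurable_fun setT (fun x : R => - (t * x)).
    by apply: (measurableT_comp (@oppr_measurable R setT)); exact: measurable_funM.
  exact: (measurableT_comp (@measurable_expR R) mt).
move=> x; rewrite /= in_itv/= andbT => x0; rewrite lee_fin normrM [leRHS]normrM.
by rewrite ler_wpM2r// (le_trans (qC _ x0))// ler_norm.
Qed.

Section levy_integral.
Context {R : realType}.
Local Notation leb := (@lebesgue_measure R).
Variables (F Gm1 Gm2 Gp1 Gp2 : {measure set R -> \bar R}) (mm mp : R).
Hypotheses (wm1 : weighted mm Gm1) (wm2 : weighted mm Gm2).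
Hypotheses (wp1 : weighted mp Gp1) (wp2 : weighted mp Gp2).
Hypothesis Lm_ge0 : forall x, 0 < x -> 0 <= slaplace Gm1 Gm2 x.
Hypothesis Lp_ge0 : forall x, 0 < x -> 0 <= slaplace Gp1 Gp2 x.
Let f (x : R) : R := \1_`]-oo, 0[ x * slaplace Gm1 Gm2 (- x) +
                     \1_`]0, +oo[ x * slaplace Gp1 Gp2 x.
Hypothesis Ff : has_levy_density F f.

Let f_ge0 x : 0 <= f x.
Proof.
rewrite /f addr_ge0// indicE; case: (boolP (x \in _)) => [|_]; rewrite ?mul0r//.
  by rewrite inE/= in_itv/= => x0; rewrite mul1r Lm_ge0// oppr_gt0.
by rewrite inE/= in_itv/= andbT => x0; rewrite mul1r Lp_ge0.
Qed.

Let indicN x : \1_(`]-oo, 0[%classic : set R) x = \1_(`]0, +oo[%classic : set R) (- x) :> R.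
Proof.
rewrite !indicE; congr (_%:R); congr nat_of_bool.
by apply/idP/idP; rewrite !inE/= !in_itv/= andbT oppr_gt0.
Qed.

Let fE x : f x =
  (\1_`]0, +oo[ (- x) * laplace Gm1 (- x) - \1_`]0, +oo[ (- x) * laplace Gm2 (- x)) +
  (\1_`]0, +oo[ x * laplace Gp1 x - \1_`]0, +oo[ x * laplace Gp2 x).
Proof. by rewrite /f indicN /slaplace -!mulrBr. Qed.

Let measurable_f : measurable_fun setT f.
Proof.
have mN (h : R -> R) : measurable_fun setT h ->
    measurable_fun setT (fun x : R => h (- x)).
  by move=> mh; exact: (measurableT_comp mh).
rewrite (funext fE); apply: measurable_funD; apply: measurable_funB.
- exact: (mN _ (measurable_laplace _ _ _ wm1)).
- exact: (mN _ (measurable_laplace _ _ _ wm2)).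
- exact: measurable_laplace wp1.
- exact: measurable_laplace wp2.
Qed.

(** Fubini is applied to each of the four measures, the negative half-axis being reflected onto the
    positive one. Positivity of the two signed transforms makes [f] a genuine density, through which
    the four integrals are recombined into one against [F]. *)
Lemma levy_integral (q Qm Qp : R -> R) (C : R) : 0 <= C -> measurable_fun setT q ->
  (forall x, 0 < x -> `|q x| <= C * (1 - expR (- x)) ^+ 2) ->
  (forall x, 0 < x -> `|q (- x)| <= C * (1 - expR (- x)) ^+ 2) ->
  (forall t, 0 < t -> has_laplace q t (Qp t)) ->
  (forall t, 0 < t -> has_laplace (fun x => q (- x)) t (Qm t)) ->
  F.-integrable setT (fun x => (q x)%:E) /\
  Rintegral F setT q =
  (Rintegral Gm1 setT (fun t => \1_(half_line mm) t * Qm t) -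
   Rintegral Gm2 setT (fun t => \1_(half_line mm) t * Qm t)) +
  (Rintegral Gp1 setT (fun t => \1_(half_line mp) t * Qp t) -
   Rintegral Gp2 setT (fun t => \1_(half_line mp) t * Qp t)).
Proof.
move=> C0 mq qC qNC qQp qQm.
have mqN : measurable_fun setT (fun x : R => q (- x)) by exact: (measurableT_comp mq).
have [ip1 ep1] := laplace_Fubini_weighted _ _ _ _ _ _ wp1 C0 mq qC qQp.
have [ip2 ep2] := laplace_Fubini_weighted _ _ _ _ _ _ wp2 C0 mq qC qQp.
have [im1 em1] := laplace_Fubini_weighted _ _ _ _ _ _ wm1 C0 mqN qNC qQm.
have [im2 em2] := laplace_Fubini_weighted _ _ _ _ _ _ wm2 C0 mqN qNC qQm.
have [jm1 fm1] := integrable_lebesgueN _ im1.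
have [jm2 fm2] := integrable_lebesgueN _ im2.
have iB (g h : R -> R) : leb.-integrable setT (fun x => (g x)%:E) ->
    leb.-integrable setT (fun x => (h x)%:E) ->
    leb.-integrable setT (fun x => (g x - h x)%:E).
  by move=> ig ih; apply: (eq_integrable _ _ _ _ (integrableB _ ig ih)).
have iD (g h : R -> R) : leb.-integrable setT (fun x => (g x)%:E) ->
    leb.-integrable setT (fun x => (h x)%:E) ->
    leb.-integrable setT (fun x => (g x + h x)%:E).
  by move=> ig ih; apply: (eq_integrable _ _ _ _ (integrableD _ ig ih)).
(* The double negation displays the first two terms as reflections of the functions integrated by
   Fubini on the positive axis. *)
have qfE x : q x * f x =
    (\1_`]0, +oo[ (- x) * q (- - x) * laplace Gm1 (- x) -
     \1_`]0, +oo[ (- x) * q (- - x) * laplace Gm2 (- x)) +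
    (\1_`]0, +oo[ x * q x * laplace Gp1 x - \1_`]0, +oo[ x * q x * laplace Gp2 x).
  by rewrite fE opprK; ring.
have iqf : leb.-integrable setT (fun x => (q x * f x)%:E).
  under eq_fun do rewrite qfE.
  exact: (iD _ _ (iB _ _ jm1 jm2) (iB _ _ ip1 ip2)).
have [iF ->] := integrable_levy_density _ _ _ f_ge0 measurable_f Ff mq iqf.
split; first exact: iF.
rewrite (funext qfE) (RintegralD measurableT (iB _ _ jm1 jm2) (iB _ _ ip1 ip2)).
rewrite (RintegralB measurableT jm1 jm2) (RintegralB measurableT ip1 ip2).
by rewrite fm1 fm2 em1 em2 ep1 ep2.
Qed.

End levy_integral.
Lemma has_laplace_sin (R : realType) (xi t : R) : 0 < t ->
  has_laplace (fun x => - sin (x * xi) + xi * (1 - expR (- x))) t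
    (- (xi / (t ^+ 2 + xi ^+ 2)) + xi * (t^-1 - (1 + t)^-1)).
Proof.
move=> t0; have h0 := has_laplace_expR 0 t; rewrite add0r in h0.
have h1 := has_laplace_expR 1 t (addr_gt0 ltr01 t0).
have hs := has_laplaceB _ _ _ _ _ (has_laplace_onem_sin xi t t0) (h0 t0).
have he := has_laplaceZ (- xi) _ _ _ (has_laplaceB _ _ _ _ _ (h0 t0) h1).
have := has_laplaceB _ _ _ _ _ hs he.
rewrite (_ : _ - _ = - (xi / (t ^+ 2 + xi ^+ 2)) + xi * (t^-1 - (1 + t)^-1)); last first.
  by move: (_ / _) => w; ring.
apply: has_laplace_ext => x _; rewrite mul0r mul1r oppr0 expR0; ring.
Qed.

Lemma cexp_i (R : realType) (a : R) : cexp ('i%C * a%:C%C) = (cos a +i* sin a)%C.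
Proof. by rewrite /cexp /= !(mul0r, mulr0, mul1r, subr0, add0r, oppr0, expR0). Qed.

(** * The Levy-Khintchine exponent through Stieltjes transforms *)

Section levy_khintchine_stieltjes.
Context {R : realType}.
Variables (F Gm1 Gm2 Gp1 Gp2 : {measure set R -> \bar R}) (mm mp : R).
Hypotheses (wm1 : weighted mm Gm1) (wm2 : weighted mm Gm2).
Hypotheses (wp1 : weighted mp Gp1) (wp2 : weighted mp Gp2).
Hypothesis Lm_ge0 : forall x, 0 < x -> 0 <= slaplace Gm1 Gm2 x.
Hypothesis Lp_ge0 : forall x, 0 < x -> 0 <= slaplace Gp1 Gp2 x.
Hypothesis Ff : has_levy_density F
  (fun x => \1_`]-oo, 0[ x * slaplace Gm1 Gm2 (- x) +
            \1_`]0, +oo[ x * slaplace Gp1 Gp2 x).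

(* Odd extension of [1 - e^{-x}]: replacing the truncation [x 1_{|x| <= 1}] by it
   makes the Laplace transform of the kernel rational. *)
Definition soft_truncation (x : R) : R :=
  \1_`]0, +oo[ x * (1 - expR (- x)) - \1_`]-oo, 0[ x * (1 - expR x).

Let soft_pos x : 0 < x -> soft_truncation x = 1 - expR (- x).
Proof.
move=> x0; rewrite /soft_truncation !indicE mem_set ?memNset//=.
- by rewrite mul1r mul0r subr0.
- by rewrite in_itv/= ltNge ltW.
- by rewrite in_itv/= x0.
Qed.

Let soft_neg x : 0 < x -> soft_truncation (- x) = - (1 - expR (- x)).
Proof.
move=> x0; rewrite /soft_truncation !indicE memNset ?mem_set//=.
- by rewrite mul1r mul0r sub0r.
- by rewrite in_itv/= oppr_lt0.
- by rewrite in_itv/= andbT oppr_gt0 ltNge ltW.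
Qed.

Let measurable_soft : measurable_fun setT soft_truncation.
Proof.
apply: measurable_funB; apply: measurable_funM.
- by apply: measurable_indic; exact: measurable_itv.
- by apply: measurable_funB => //; exact: (measurableT_comp (@measurable_expR R)).
- by apply: measurable_indic; exact: measurable_itv.
- by apply: measurable_funB.
Qed.

Let measurable_scaled (g : R -> R) (xi : R) : continuous g ->
  measurable_fun setT (fun x : R => g (x * xi)).
Proof.
move=> cg; have mg : measurable_fun setT g.
  by apply: (open_continuous_measurable_fun openT) => x _; exact: cg.
by apply: (measurableT_comp mg); exact: measurable_funM.
Qed.

Let sin_part xi (x : R) := - sin (x * xi) + xi * soft_truncation x.

Let measurable_sin_part xi : measurable_fun setT (sin_part xi).
Proof.
apply: measurable_funD; last exact: measurable_funM.
apply: (measurableT_comp (@oppr_measurable R setT)).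
by apply: measurable_scaled; exact: continuous_sin.
Qed.

Let cos_integral xi :
  F.-integrable setT (fun x => (1 - cos (x * xi))%:E) /\
  Rintegral F setT (fun x => 1 - cos (x * xi)) =
  (Rintegral Gm1 setT (fun t => \1_(half_line mm) t *
     (t^-1 - t / (t ^+ 2 + (- xi) ^+ 2))) -
   Rintegral Gm2 setT (fun t => \1_(half_line mm) t *
     (t^-1 - t / (t ^+ 2 + (- xi) ^+ 2)))) +
  (Rintegral Gp1 setT (fun t => \1_(half_line mp) t * (t^-1 - t / (t ^+ 2 + xi ^+ 2))) -
   Rintegral Gp2 setT (fun t => \1_(half_line mp) t * (t^-1 - t / (t ^+ 2 + xi ^+ 2)))).
Proof.
have mq : measurable_fun setT (fun x : R => 1 - cos (x * xi)).
  by apply: measurable_funB => //; apply: measurable_scaled; exact: continuous_cos.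
have C0 : 0 <= 4 * (xi ^+ 2 + 2) by rewrite mulr_ge0// addr_ge0// sqr_ge0.
apply: (levy_integral _ _ _ _ _ _ _ wm1 wm2 wp1 wp2 Lm_ge0 Lp_ge0 Ff _ _ _ _ C0 mq).
- by move=> x; exact: onem_cos_domination.
- by move=> x x0; rewrite mulNr cosN onem_cos_domination.
- by move=> t; exact: has_laplace_onem_cos.
- move=> t t0; apply: has_laplace_ext (has_laplace_onem_cos (- xi) t t0) => x _.
  by rewrite mulrN mulNr.
Qed.

Let sin_integral xi :
  F.-integrable setT (fun x => (sin_part xi x)%:E) /\
  Rintegral F setT (sin_part xi) =
  (Rintegral Gm1 setT (fun t => \1_(half_line mm) t *
     (- (- xi / (t ^+ 2 + (- xi) ^+ 2)) + - xi * (t^-1 - (1 + t)^-1))) -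
   Rintegral Gm2 setT (fun t => \1_(half_line mm) t *
     (- (- xi / (t ^+ 2 + (- xi) ^+ 2)) + - xi * (t^-1 - (1 + t)^-1)))) +
  (Rintegral Gp1 setT (fun t => \1_(half_line mp) t *
     (- (xi / (t ^+ 2 + xi ^+ 2)) + xi * (t^-1 - (1 + t)^-1))) -
   Rintegral Gp2 setT (fun t => \1_(half_line mp) t *
     (- (xi / (t ^+ 2 + xi ^+ 2)) + xi * (t^-1 - (1 + t)^-1)))).
Proof.
have C0 : 0 <= 4 * (xi ^+ 2 + `|xi| + (1 + `|xi|)).
  by rewrite mulr_ge0// !addr_ge0// sqr_ge0.
have negE x : 0 < x ->
    sin_part xi (- x) = - sin (x * - xi) + - xi * (1 - expR (- x)).
  by move=> x0; rewrite /sin_part soft_neg// !mulNr !mulrN.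
apply: (levy_integral _ _ _ _ _ _ _ wm1 wm2 wp1 wp2 Lm_ge0 Lp_ge0 Ff _ _ _ _ C0
  (measurable_sin_part xi)).
- by move=> x x0; rewrite /sin_part soft_pos// sin_domination.
- move=> x x0; rewrite negE//; have := sin_domination (- xi) x x0.
  by rewrite sqrrN normrN.
- move=> t t0; apply: has_laplace_ext (has_laplace_sin _ xi t t0) => x x0.
  by rewrite /sin_part soft_pos.
- move=> t t0; apply: has_laplace_ext (has_laplace_sin _ (- xi) t t0) => x x0.
  by rewrite negE.
Qed.

Let truncation_gap (x : R) : R := x * (`|x| <= 1)%R%:R - soft_truncation x.

Let measurable_truncation_gap : measurable_fun setT truncation_gap.
Proof.
apply: measurable_funB; last exact: measurable_soft.
apply: measurable_funM => //.
rewrite (_ : (fun x : R => _) = \1_(`[-1, 1]%classic : set R)).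
  by apply: measurable_indic; exact: measurable_itv.
apply/funext => x; rewrite indicE ler_norml; congr (_%:R); congr nat_of_bool.
by apply/idP/idP; rewrite inE/= in_itv.
Qed.

(** Both truncations agree with [x] to first order at 0 and are bounded, so their difference lies
    under the common majorant. *)
Let integrable_truncation_gap : F.-integrable setT (fun x => (truncation_gap x)%:E).
Proof.
have C0 : 0 <= 4 * (1 + 1) :> R by rewrite mulr_ge0.
have dp x : 0 < x -> `|truncation_gap x| <= 4 * (1 + 1) * (1 - expR (- x)) ^+ 2.
  by move=> x0; rewrite /truncation_gap soft_pos// truncation_domination.
have dn x : 0 < x -> `|truncation_gap (- x)| <= 4 * (1 + 1) * (1 - expR (- x)) ^+ 2.
  move=> x0; have <- : `|truncation_gap x| = `|truncation_gap (- x)|; last exact: dp.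
  by rewrite /truncation_gap soft_pos// soft_neg// mulNr -opprD !normrN.
have mN : measurable_fun setT (fun x : R => truncation_gap (- x)).
  exact: (measurableT_comp measurable_truncation_gap).
have [] // := levy_integral _ _ _ _ _ _ _ wm1 wm2 wp1 wp2 Lm_ge0 Lp_ge0 Ff _ _ _ _ C0
  measurable_truncation_gap dp dn
  (fun t t0 => has_laplace_dominated _ _ _ _ t0 measurable_truncation_gap dp)
  (fun t t0 => has_laplace_dominated _ _ _ _ t0 mN dn).
Qed.

Definition stieltjes_part (G : {measure set R -> \bar R}) (m : R) (u : R[i]) : R[i] :=
  - u * (1 + u) * stieltjes G m u.

Lemma levy_khintchine0_stieltjes (sigma2 : R) : exists E : R, forall xi : R,
  levy_khintchine0 sigma2 F xi =
  (sigma2 / 2)%:C%C * xi%:C%C ^+ 2 + 'i%C * E%:C%C * xi%:C%C +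
  ((stieltjes_part Gm1 mm (- 'i%C * xi%:C%C) - stieltjes_part Gm2 mm (- 'i%C * xi%:C%C)) +
   (stieltjes_part Gp1 mp ('i%C * xi%:C%C) - stieltjes_part Gp2 mp ('i%C * xi%:C%C))).
Proof.
(* The gap enters the imaginary part multiplied by [xi], so its integral is the drift correction,
   and it does not depend on [xi]. *)
exists (Rintegral F setT truncation_gap) => xi.
have iN : - 'i%C * xi%:C%C = 'i%C * (- xi)%:C%C :> R[i] by rewrite rmorphN mulrN mulNr.
rewrite iN /stieltjes_part !stieltjes_imaginary//.
have [ic ec] := cos_integral xi; have [is' es] := sin_integral xi.
have -> : levy_khintchine0 sigma2 F xi = (sigma2 / 2 * xi ^+ 2)%:C%C +
    (Rintegral F setT (fun x => 1 - cos (x * xi)) +i*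
     (Rintegral F setT (sin_part xi) + xi * Rintegral F setT truncation_gap))%C.
  rewrite /levy_khintchine0 /cintegral; congr (_ + (_ +i* _)%C).
    apply: eq_Rintegral => x _; rewrite cexp_i/=; ring.
  rewrite -RintegralZl// -RintegralD//.
    by apply: eq_Rintegral => x _; rewrite cexp_i/= /sin_part /truncation_gap; ring.
  by apply: (eq_integrable _ _ _ _ (integrableZl _ xi integrable_truncation_gap)).
rewrite ec es rmorphM/= rmorphXn/=.
by apply/eqP; rewrite eq_complex/=; apply/andP; split; apply/eqP; ring.
Qed.

End levy_khintchine_stieltjes.
(** * Continuation and growth *)

(** The moduli at t = 1 give the real parts. A single time determines the imaginary part only modulo
    2 pi; were the imaginary parts to differ by d, the time pi / |d| would make cos (t d) equal to
    -1, while equality of the exponentials forces 1. *)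
Lemma cexp_time_inj (R : realType) (a b : R[i]) :
  (forall t : R, 0 <= t -> cexp (- (t%:C%C * a)) = cexp (- (t%:C%C * b))) -> a = b.
Proof.
case: a b => [a1 a2] [b1 b2] ab.
have abE t : 0 <= t ->
    (expR (- (t * a1)) * cos (t * a2) = expR (- (t * b1)) * cos (t * b2)) /\
    (expR (- (t * a1)) * sin (t * a2) = expR (- (t * b1)) * sin (t * b2)).
  move=> /ab; rewrite /cexp /= !mul0r !subr0 !addr0 !cosN !sinN !mulrN.
  by move=> [e1 /oppr_inj e2].
have e1 : a1 = b1.
  have [ec es] := abE 1 ler01; rewrite !mul1r in ec es.
  have : expR (- a1) ^+ 2 = expR (- b1) ^+ 2.
    rewrite -[LHS]mulr1 -(cos2Dsin2 a2) -[RHS]mulr1 -(cos2Dsin2 b2) !mulrDr.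
    by rewrite -!exprMn ec es.
  move/eqP; rewrite eqrXn2 ?expR_ge0// => /eqP /expR_inj.
  exact: oppr_inj.
move: abE; rewrite {}e1 => abE.
have key t : 0 <= t -> cos (t * (a2 - b2)) = 1.
  move=> t0; have [ec es] := abE t t0; have en0 : expR (- (t * b1)) != 0.
    by rewrite gt_eqF// expR_gt0.
  move/(mulfI en0) : ec => ec; move/(mulfI en0) : es => es.
  by rewrite mulrBr cosB ec es -!expr2 cos2Dsin2.
congr (_ +i* _)%C; apply/eqP; rewrite -subr_eq0; apply/negPn/negP => d0.
have n0 : 0 < `|a2 - b2| by rewrite normr_gt0.
have := key (pi / `|a2 - b2|) (divr_ge0 (pi_ge0 R) (ltW n0)).
have -> : cos (pi / `|a2 - b2| * (a2 - b2)) = -1.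
  have [h|h] := ltrP 0 (a2 - b2).
    by rewrite gtr0_norm// divfK// cospi.
  by rewrite ler0_norm// invrN mulrN mulNr cosN divfK// cospi.
by move=> h; have : 0 < 1 :> R by []; lra.
Qed.

Section complex_derivative_rules.
Context {R : realType}.
Implicit Types (z : R[i]).
Lemma derivable_cM (f g : R[i] -> R[i]) z :
  derivable (f : R[i]^o -> R[i]^o) z 1 -> derivable (g : R[i]^o -> R[i]^o) z 1 ->
  derivable ((fun w => f w * g w) : R[i]^o -> R[i]^o) z 1.
Proof. exact: derivableM. Qed.

Lemma derivable_cD (f g : R[i] -> R[i]) z :
  derivable (f : R[i]^o -> R[i]^o) z 1 -> derivable (g : R[i]^o -> R[i]^o) z 1 ->
  derivable ((fun w => f w + g w) : R[i]^o -> R[i]^o) z 1.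
Proof. exact: derivableD. Qed.

Lemma derivable_cN (f : R[i] -> R[i]) z :
  derivable (f : R[i]^o -> R[i]^o) z 1 ->
  derivable ((fun w => - f w) : R[i]^o -> R[i]^o) z 1.
Proof. exact: derivableN. Qed.

Lemma derivable_ccst (a : R[i]) z : derivable ((fun=> a) : R[i]^o -> R[i]^o) z 1.
Proof. exact: derivable_cst. Qed.

Lemma derivable_cid z : derivable ((fun w => w) : R[i]^o -> R[i]^o) z 1.
Proof. exact: derivable_id. Qed.

End complex_derivative_rules.

Section stieltjes_part.
Context {R : realType}.
Variables (G : {measure set R -> \bar R}) (m : R).
Hypothesis Gw : weighted m G.
Local Notation normc := (@Normc.normc R).
Implicit Types (u z a : R[i]).

Lemma derivable_stieltjes_part a z c : normc a = 1 -> separated m c (a * z) ->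
  derivable ((fun z => stieltjes_part G m (a * z)) : R[i]^o -> R[i]^o) z 1.
Proof.
move=> a1 sep; have dS := derivable_stieltjes G m Gw a z c a1 sep.
have da : derivable ((fun z => a * z) : R[i]^o -> R[i]^o) z 1.
  by apply: derivable_cM; [exact: derivable_ccst|exact: derivable_cid].
apply: (derivable_cM (fun z => - (a * z) * (1 + a * z)) _ z _ dS).
apply: (derivable_cM (fun z => - (a * z))); first exact: derivable_cN.
by apply: derivable_cD; [exact: derivable_ccst|exact: da].
Qed.

Lemma normc_stieltjes_part_le u c : separated m c u ->
  normc (stieltjes_part G m u) <=
  normc u * (1 + normc u) * (2 * (c^-1 * Rintegral G setT (weight m))).
Proof.
move=> sep; rewrite /stieltjes_part !Normc.normcM normcN_real.
apply: ler_pM; rewrite ?mulr_ge0 ?normc_ge0//; last exact: normc_stieltjes_le.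
rewrite ler_wpM2l ?normc_ge0// (le_trans (ler_normcD _ _))//.
by rewrite Normc.normc1.
Qed.

End stieltjes_part.

Section strip_cone.
Context {R : realType}.
Local Notation normc := (@Normc.normc R).

(** The conclusion describes the plane cut along the imaginary rays above [mup] and below [mum]. Its
    two alternatives become those of [separated_strip] after multiplication by ['i] or [- 'i]. *)
Lemma strip_cone_halfpi (mum mup : R) (z : R[i]) :
  strip_cone mum mup (- (pi / 2)) (pi / 2) z ->
  complex.Re z != 0 \/ mum < complex.Im z < mup.
Proof.
move=> [a am [w [|->]]]; last first.
  move=> <-; right; move: am; rewrite /= in_itv/=.
  by rewrite mul0r mul1r addr0 add0r.
rewrite cone_halfpi/= => w0 <-; left; case: w w0 => x y /= x0.
by rewrite mul0r mulr0 subr0 add0r.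
Qed.

Lemma polarE (rho phi : R) :
  polar rho phi = ((rho * cos phi) +i* (rho * sin phi))%C.
Proof.
rewrite /polar cexp_i; apply/eqP; rewrite eq_complex /=.
by rewrite !mul0r subr0 addr0 !eqxx.
Qed.

Lemma normc_polar (rho phi : R) : 0 <= rho -> normc (polar rho phi) = rho.
Proof.
move=> rho0; rewrite polarE /= !exprMn -mulrDr cos2Dsin2 mulr1.
by rewrite sqrtr_sqr ger0_norm.
Qed.

(** Cosine is even and decreasing on [0, pi], so its minimum over the sector is attained at an
    endpoint. The bound keeps Re z >= k |z|, hence a uniform relative distance to the cuts. *)
Lemma cos_lower_bound (g1 g2 : R) : - (pi / 2) < g1 < 0 -> 0 < g2 < pi / 2 ->
  exists2 k : R, 0 < k <= 1 & forall phi, g1 <= phi <= g2 -> k <= cos phi.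
Proof.
move=> /andP[g1l g10] /andP[g20 g2r]; have pi0 := pi_gt0 R.
exists (Num.min (cos g1) (cos g2)).
  rewrite lt_min !cos_gt0_pihalf/= ?ge_min ?cos_le1//; apply/andP; split; lra.
have cos_le (x y : R) : 0 <= x -> x <= y -> y <= pi -> cos y <= cos x.
  move=> x0 xy ypi; have x1 : x \in `[0, pi] by rewrite in_itv/= x0 (le_trans xy).
  have y1 : y \in `[0, pi] by rewrite in_itv/= (le_trans x0).
  by rewrite leNgt (ltr_cos y1 x1) -leNgt.
move=> phi /andP[h1 h2]; have [p0|p0] := leP 0 phi.
  by rewrite ge_min; apply/orP; right; apply: cos_le => //; lra.
rewrite ge_min; apply/orP; left; rewrite -[cos phi]cosN -[cos g1]cosN.
by apply: cos_le; lra.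
Qed.

End strip_cone.

Lemma separated_strip (R : realType) (m : R) (u : R[i]) :
  complex.Im u != 0 \/ complex.Re u < m -> exists c, separated m c u.
Proof.
move=> [u0|um]; eexists; last exact: separated_Re um.
by apply: (separated_Im m u `|complex.Im u|); rewrite ?normr_gt0 ?lexx.
Qed.

(** The constant is 12 = 2 * 2 * 3: one 2 from rho (1 + rho) <= 2 rho^2, one from the complex
    integral bound, and 3 / k from inverting the separation constant, using k <= 1 < rho. *)
Lemma stieltjes_part_growth (R : realType) (G : {measure set R -> \bar R})
    (m k rho phi : R) (a : R[i]) :
  weighted m G -> 0 < k <= 1 -> k <= cos phi -> 1 < rho -> Normc.normc a = 1 ->
  (forall z : R[i], `|complex.Im (a * z)| = `|complex.Re z|) ->
  Normc.normc (stieltjes_part G m (a * polar rho phi)) <=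
  12 / k * Rintegral G setT (weight m) * rho ^+ 2.
Proof.
move=> Gw /andP[k0 k1] kphi rho1 a1 aI; have rho0 : 0 < rho by lra.
have kr0 : 0 < k * rho by rewrite mulr_gt0.
have na : Normc.normc (a * polar rho phi) = rho.
  by rewrite Normc.normcM a1 mul1r normc_polar// ltW.
have krI : k * rho <= `|complex.Im (a * polar rho phi)|.
  rewrite aI polarE/= normrM (gtr0_norm rho0) mulrC ler_pM2l//.
  by rewrite (le_trans kphi)// ler_norm.
have := normc_stieltjes_part_le G m Gw _ _ (separated_Im m _ _ kr0 krI).
rewrite na => /le_trans; apply.
set I := Rintegral _ _ _; have I0 : 0 <= I.
  by apply: Rintegral_ge0 => t _; exact: weight_ge0.
have c3 : (k * rho / (1 + rho + k * rho))^-1 <= 3 / k.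
  rewrite invf_div ler_pdivrMr// mulrA divfK ?gt_eqF//; nra.
have r2 : rho * (1 + rho) <= 2 * rho ^+ 2 by nra.
have cI : 2 * ((k * rho / (1 + rho + k * rho))^-1 * I) <= 2 * (3 / k * I).
  by rewrite ler_pM2l// ler_wpM2r.
apply: (@le_trans _ _ (2 * rho ^+ 2 * (2 * (3 / k * I)))).
  apply: ler_pM => //; first by rewrite mulr_ge0 ?addr_ge0 ?(ltW rho0).
  by rewrite !mulr_ge0// invr_ge0 divr_ge0 ?addr_ge0 ?(ltW rho0) ?(ltW kr0).
by rewrite le_eqVlt; apply/orP; left; apply/eqP; field; rewrite gt_eqF.
Qed.

Theorem proposition3p32 (R : realType) (d : measure_display)
    (Omega : measurableType d) (P : probability Omega R)
    (X : R -> {RV P >-> R}) (psi : R -> R[i]) (mum mup g'm g'p : R)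
    (nu' : order_index R) :
  mum <= 0 -> 0 <= mup -> mum < mup ->
  levy_process X -> sSL mum mup X -> characteristic_exponent X psi ->
  - (pi / 2) <= g'm -> g'm <= 0 -> 0 <= g'p -> g'p <= pi / 2 ->
  0 < `|g'm| + g'p ->
  (* the continuation Psi of psi is unique, and its existence is not assumed *)
  (forall Psi : R[i] -> R[i],
     analytic_continuation (strip_cone mum mup (- (pi / 2)) (pi / 2)) psi Psi ->
     lower_growth Psi g'm g'p nu') ->
  exists nu : order_index R,
    [/\ order_le nu' nu, order_le nu order_two &
        SINH_regular X mum mup (- (pi / 2)) (pi / 2) g'm g'p nu' nu].
Proof.
move=> mum0 mup0 mumup _ [sigma2 [mu [F [Gm1 [Gm2 [Gp1 [Gp2
  [trip [Sm1 Sm2 Lm0] [Sp1 Sp2 Lp0] Ff]]]]]]]] Xpsi g'm0 g'm1 g'p0 g'p1 g'mp low.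
have wm1 := SLM_weighted _ _ Sm1; have wm2 := SLM_weighted _ _ Sm2.
have wp1 := SLM_weighted _ _ Sp1; have wp2 := SLM_weighted _ _ Sp2.
have [E LK] := levy_khintchine0_stieltjes _ _ _ _ _ _ _ wm1 wm2 wp1 wp2 Lm0 Lp0 Ff sigma2.
pose Psi0 (z : R[i]) : R[i] :=
  (sigma2 / 2)%:C%C * z ^+ 2 + 'i%C * E%:C%C * z +
  ((stieltjes_part Gm1 mup (- 'i%C * z) - stieltjes_part Gm2 mup (- 'i%C * z)) +
   (stieltjes_part Gp1 (- mum) ('i%C * z) - stieltjes_part Gp2 (- mum) ('i%C * z))).
pose Psi z := - ('i%C * mu%:C%C * z) + Psi0 z.
(* Both sides are exponents of the same characteristic functions at all times t >= 0. *)
have psiE : psi = levy_khintchine sigma2 mu F.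
  have [_ _ XLK] := trip; apply/funext => xi; apply: cexp_time_inj => t t0.
  by rewrite -Xpsi// XLK.
have iM (z : R[i]) : complex.Re ('i%C * z) = - complex.Im z /\
                     complex.Im ('i%C * z) = complex.Re z.
  by case: z => x y /=; rewrite !(mul0r, mul1r, add0r, sub0r).
have iNM (z : R[i]) : complex.Re (- 'i%C * z) = complex.Im z /\
                      complex.Im (- 'i%C * z) = - complex.Re z.
  by case: z => x y /=; rewrite !(mul0r, mulN1r, oppr0, add0r, sub0r, opprK).
have ni : Normc.normc ('i%C : R[i]) = 1 by rewrite /= expr0n expr1n add0r sqrtr1.
have nNi : Normc.normc (- 'i%C : R[i]) = 1 by rewrite normcN_real.
have derPsi0 : holomorphic_on (strip_cone mum mup (- (pi / 2)) (pi / 2)) Psi0.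
  move=> z /strip_cone_halfpi Dz.
  (* Re (- i z) = Im z and Re (i z) = - Im z, so on the imaginary axis [mup] bounds the transforms
     of the negative jumps and [- mum] those of the positive ones. *)
  have [cm sm] : exists c, separated mup c (- 'i%C * z).
    apply: separated_strip; rewrite (iNM z).1 (iNM z).2 oppr_eq0.
    by case: Dz => [?|/andP[_ ?]]; [left|right].
  have [cp sp] : exists c, separated (- mum) c ('i%C * z).
    apply: separated_strip; rewrite (iM z).1 (iM z).2 ltrN2.
    by case: Dz => [?|/andP[? _]]; [left|right].
  have did := derivable_cid z.
  have dT G m a (Gw : weighted m G) (na : Normc.normc a = 1) c
      (sep : separated m c (a * z)) := derivable_stieltjes_part G m Gw a z c na sep.
  have dB (f g : R[i] -> R[i]) (df : derivable (f : R[i]^o -> R[i]^o) z 1)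
      (dg : derivable (g : R[i]^o -> R[i]^o) z 1) :=
    derivable_cD f (fun w => - g w) z df (derivable_cN g z dg).
  have dm := dB _ _ (dT _ _ _ wm1 nNi _ sm) (dT _ _ _ wm2 nNi _ sm).
  have dp := dB _ _ (dT _ _ _ wp1 ni _ sp) (dT _ _ _ wp2 ni _ sp).
  apply: (derivable_cD (fun w => (sigma2 / 2)%:C%C * w ^+ 2 + 'i%C * E%:C%C * w) _ z _
    (derivable_cD _ _ z dm dp)).
  apply: (derivable_cD (fun w => (sigma2 / 2)%:C%C * w ^+ 2)).
    apply: (derivable_cM (fun=> (sigma2 / 2)%:C%C)); first exact: derivable_ccst.
    exact: (derivable_cM _ _ z did did).
  by apply: (derivable_cM (fun=> 'i%C * E%:C%C)); [exact: derivable_ccst|exact: did].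
have derPsi : holomorphic_on (strip_cone mum mup (- (pi / 2)) (pi / 2)) Psi.
  move=> z Dz; apply: (derivable_cD (fun w => - ('i%C * mu%:C%C * w)) Psi0 z);
    last exact: derPsi0.
  apply: (derivable_cN (fun w => 'i%C * mu%:C%C * w)).
  apply: (derivable_cM (fun=> 'i%C * mu%:C%C)); first exact: derivable_ccst.
  exact: derivable_cid.
have Psi0E (x : R) : Psi0 x%:C%C = levy_khintchine0 sigma2 F x by rewrite LK.
have pi0 := pi_gt0 R.
exists order_two; split.
- by case: nu' {low} => [a ha||] //=; [have /andP[] := ha|rewrite ltr1n].
- exact: lexx.
split.
- by have [mum00|mum00] := ltP mum 0; [left; rewrite mup0|right; rewrite mum0/=; lra].
- by apply/andP; split; lra.
- by split=> //; apply/andP.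
exists sigma2, mu, F, Psi0; split => //.
  move=> g1m g1p g1m0 g1p0; have [k k0 kphi] := cos_lower_bound _ _ g1m0 g1p0.
  pose I (G : {measure set R -> \bar R}) (m : R) := 12 / k * Rintegral G setT (weight m).
  (* One summand for each term of [Psi]; the final 1 only makes the constant strictly positive, and
     the threshold 1 allows linear terms to be absorbed by rho <= rho^2. *)
  exists (`|mu| + (`|sigma2 / 2| + `|E| + (I Gm1 mup + I Gm2 mup +
    (I Gp1 (- mum) + I Gp2 (- mum)))) + 1), 1; split => //.
    have I0 G m : 0 <= I G m.
      rewrite /I mulr_ge0 ?divr_ge0//; first by case/andP: k0 => /ltW.
      by apply: Rintegral_ge0 => t _; exact: weight_ge0.
    by rewrite ltr_pwDr// !addr_ge0.
  move=> phi rho /kphi kp rho1; have rho0 : 0 < rho by lra.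
  have nz : Normc.normc (polar rho phi) = rho by rewrite normc_polar// ltW.
  have aI (z : R[i]) : `|complex.Im ('i%C * z)| = `|complex.Re z| by rewrite (iM z).2.
  have aNI (z : R[i]) : `|complex.Im (- 'i%C * z)| = `|complex.Re z|.
    by rewrite (iNM z).2 normrN.
  have gm1 := stieltjes_part_growth _ _ _ _ _ _ _ wm1 k0 kp rho1 nNi aNI.
  have gm2 := stieltjes_part_growth _ _ _ _ _ _ _ wm2 k0 kp rho1 nNi aNI.
  have gp1 := stieltjes_part_growth _ _ _ _ _ _ _ wp1 k0 kp rho1 ni aI.
  have gp2 := stieltjes_part_growth _ _ _ _ _ _ _ wp2 k0 kp rho1 ni aI.
  have rr : rho <= rho ^+ 2 by rewrite expr2 ler_peMl ?ltW.
  have nB (x y : R[i]) (b c : R) : Normc.normc x <= b -> Normc.normc y <= c ->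
      Normc.normc (x - y) <= b + c.
    move=> xb yc; rewrite (le_trans (ler_normcD _ _))// normcN_real; exact: lerD.
  have nD (x y : R[i]) (b c : R) : Normc.normc x <= b -> Normc.normc y <= c ->
      Normc.normc (x + y) <= b + c.
    by move=> xb yc; rewrite (le_trans (ler_normcD _ _))//; exact: lerD.
  rewrite /order_two /order_pow powR_mulrn ?(ltW rho0)// !mulrDl mul1r.
  rewrite ler_wpDr ?sqr_ge0//.
  apply: (nD); [|apply: (nD); [apply: (nD)|apply: (nD); apply: nB]] => //.
  - rewrite normcN_real Normc.normcM Normc.normcM ni mul1r normc_real nz.
    by rewrite ler_wpM2l.
  - by rewrite Normc.normcM normc_real normcXn nz.
  - by rewrite Normc.normcM Normc.normcM ni mul1r normc_real nz ler_wpM2l.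
(* The assumed lower bound holds for every continuation of [psi], hence for the [Psi] just
   constructed. *)
apply: low; split => // x Dx.
by rewrite psiE /Psi Psi0E /levy_khintchine rmorphM/= mulrA.
Qed.
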